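(* Let $k\geq 2$ be an integer and let $G$ be a graph of sufficiently large order $n$. (a) If $\mu(G)\geq \mu(S_{n,k})$, then $G$ contains all brooms of order $2k+2$ (that is, every $B_{s,t}$ with $s,t\ge 1$ and $s+t=2k+2$) as subgraphs, unless $G=S_{n,k}$. (b) If $\mu(G)\geq \mu(S_{n,k}^{+})$, then $G$ contains all brooms of order $2k+3$ (that is, every $B_{s,t}$ with $s,t\ge 1$ and $s+t=2k+3$) as subgraphs, unless $G=S_{n,k}^{+}$.
   Context: All graphs are finite, simple and undirected. The order of a graph is its number of vertices; equality of graphs means isomorphism. $\mu(G)$ denotes the spectral radius of $G$, i.e. the largest eigenvalue of its adjacency matrix. ''Contains'' refers to not necessarily induced subgraphs (up to isomorphism). $S_{n,k}=K_k\vee\overline{K_{n-k}}$ is the graph of order $n$ obtained by joining every vertex of a complete graph $K_k$ to every vertex of an independent set of order $n-k$. $S_{n,k}^{+}$ is the graph obtained from $S_{n,k}$ by adding a single edge joining two vertices of the independent set of $S_{n,k}$. For integers $s,t\geq 1$, the broom $B_{s,t}$ is the tree on $s+t$ vertices obtained by identifying the center of a star $K_{1,s}$ with an end-vertex of a path $P_t$ on $t$ vertices (so $B_{1,t}=P_{t+1}$ and $B_{s,1}=K_{1,s}$). ''Sufficiently large $n$'' means $n\ge n_0$ for some threshold $n_0$ depending only on $k$. *)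

(* Defs.v *)
From HB Require Import structures.
From mathcomp Require Import all_boot all_order all_algebra.
From mathcomp Require Import classical_sets reals.
From mathcomp Require complex.

Set Implicit Arguments.
Unset Strict Implicit.
Unset Printing Implicit Defensive.

Import Order.TTheory GRing.Theory Num.Theory.
Local Open Scope ring_scope.

Record sgraph := SGraph {
  vertex :> finType;
  adj : rel vertex;
  adj_sym : symmetric adj;
  adj_irrefl : irreflexive adj }.

Arguments adj {s} : rename.

Definition graph_order (G : sgraph) : nat := #|G|.

Definition isomorphic (G H : sgraph) : Prop :=
  exists f : G -> H, bijective f /\ forall x y, adj (f x) (f y) = adj x y.

(* Not necessarily induced: edges of H go to edges of G, non-edges are free. *)
Definition contains (G H : sgraph) : Prop :=
  exists f : H -> G, injective f /\ forall x y, adj x y -> adj (f x) (f y).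

Definition adjmx (R : realType) (G : sgraph) : 'M[R]_(graph_order G) :=
  \matrix_(i, j) (adj (enum_val i) (enum_val j))%:R.

(* For a graph with at least one vertex the supremum is a maximum:
   see spectral_radius_max. *)
Definition spectral_radius (R : realType) (G : sgraph) : R :=
  sup [set x : R | eigenvalue (adjmx R G) x]%classic.

Definition complete_adj (n : nat) : rel 'I_n := fun i j => i != j.

Lemma complete_sym n : symmetric (@complete_adj n).
Proof. by move=> i j; rewrite /complete_adj eq_sym. Qed.

Lemma complete_irrefl n : irreflexive (@complete_adj n).
Proof. by move=> i; rewrite /complete_adj eqxx. Qed.

Definition complete (n : nat) : sgraph :=
  SGraph (@complete_sym n) (@complete_irrefl n).

Definition edgeless (n : nat) : sgraph :=
  @SGraph 'I_n (fun _ _ => false) (fun _ _ => erefl) (fun _ => erefl).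

Section Join.
Variables G H : sgraph.

Definition join_adj : rel (G + H)%type := fun x y =>
  match x, y with
  | inl u, inl v => adj u v
  | inr u, inr v => adj u v
  | _, _ => true
  end.

Lemma join_sym : symmetric join_adj.
Proof. by case=> x [] y //=; rewrite adj_sym. Qed.

Lemma join_irrefl : irreflexive join_adj.
Proof. by case=> x /=; rewrite adj_irrefl. Qed.

Definition graph_join : sgraph := SGraph join_sym join_irrefl.

End Join.

(* Truncated subtraction: the order is n only when k <= n. *)
Definition S_graph (n k : nat) : sgraph :=
  graph_join (complete k) (edgeless (n - k)).

(* The added edge joins the vertices numbered 0 and 1 of the independent set
   (all choices are isomorphic); nothing is added when n - k < 2. *)
Definition Splus_adj (n k : nat) : rel (S_graph n k) := fun x y =>
  adj x y ||
  match x, y with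
  | inr i, inr j => ((i == 0 :> nat) && (j == 1 :> nat)) ||
                    ((i == 1 :> nat) && (j == 0 :> nat))
  | _, _ => false
  end.

Lemma Splus_sym n k : symmetric (@Splus_adj n k).
Proof.
move=> x y; rewrite /Splus_adj adj_sym; congr (_ || _).
by case: x y => [i|i] [j|j] //=; rewrite orbC [X in X || _]andbC
  [X in _ || X]andbC.
Qed.

Lemma Splus_irrefl n k : irreflexive (@Splus_adj n k).
Proof.
by move=> x; rewrite /Splus_adj adj_irrefl; case: x => [//|[[|[|i]] ?]].
Qed.

Definition Splus_graph (n k : nat) : sgraph :=
  SGraph (@Splus_sym n k) (@Splus_irrefl n k).

(* The vertices inl i are the s leaves of the star, the vertices inr j are the
   successive vertices of the path P_t, and the end-vertex 0 of the path is
   identified with the centre of the star. Meaningful for t >= 1 only. *)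
Definition broom_adj (s t : nat) : rel ('I_s + 'I_t)%type := fun x y =>
  match x, y with
  | inl _, inl _ => false
  | inl _, inr j => j == 0 :> nat
  | inr i, inl _ => i == 0 :> nat
  | inr i, inr j => (i.+1 == j :> nat) || (j.+1 == i :> nat)
  end.

Lemma broom_sym s t : symmetric (@broom_adj s t).
Proof. by case=> x [] y //=; rewrite orbC. Qed.

Lemma broom_irrefl s t : irreflexive (@broom_adj s t).
Proof. by case=> x //=; rewrite orbb gtn_eqF. Qed.

Definition broom (s t : nat) : sgraph :=
  SGraph (@broom_sym s t) (@broom_irrefl s t).

Section SpectralRadius.
Import complex.
Local Open Scope sesquilinear_scope.
Variables (R : realType) (G : sgraph).

Local Notation C := (R[i])%C.
Local Notation toC := (real_complex R).
Local Notation A := (adjmx R G).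
Local Notation AC := (map_mx toC A).

Let eigenvalue_real (z : C) : eigenvalue AC z -> z \is Num.real.
Proof.
move=> /eigenvalueP[v vA v0].
have ACt : AC ^t* = AC.
  apply/matrixP => i j; rewrite !mxE adj_sym.
  by rewrite !rmorph_nat.
pose w := v *m v ^t*.
have wt : w ^t* = w.
  by rewrite /w trmx_mul map_mxM/= trmxCK.
have wn0 : w 0 0 != 0.
  by rewrite -dotmxE dnorm_eq0.
have Xt : (v *m AC *m v ^t*) ^t* = v *m AC *m v ^t*.
  by rewrite !trmx_mul !map_mxM/= trmxCK ACt mulmxA.
move: Xt; rewrite vA -scalemxAl -/w => /matrixP/(_ 0 0).
rewrite linearZ/= map_mxZ/= wt mxE [RHS]mxE => zz.
by apply/CrealP; exact: mulIf wn0 _ _ zz.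
Qed.

Lemma spectral_radius_max : (0 < graph_order G)%N ->
  eigenvalue A (spectral_radius R G) /\
  forall x, eigenvalue A x -> x <= spectral_radius R G.
Proof.
move=> G0.
have [rs prs] := closed_field_poly_normal (char_poly AC).
rewrite (monicP (char_poly_monic _)) scale1r in prs.
have rootE z : (z \in rs) = eigenvalue AC z.
  by rewrite eigenvalue_root_char prs root_prod_XsubC.
have eigE x : eigenvalue A x = eigenvalue AC (toC x).
  by rewrite !eigenvalue_root_char -map_char_poly fmorph_root.
pose s := [seq complex.Re z | z <- rs].
have sE x : (x \in s) = eigenvalue A x.
  apply/mapP/idP => [[z zrs ->]|Ax]; last first.
    by exists (toC x) => //; rewrite rootE -eigE.
  by rewrite eigE RRe_real -?rootE// eigenvalue_real -?rootE.
have s0 : s != [::].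
  rewrite -size_eq0 size_map; move: (size_char_poly AC).
  by rewrite prs size_prod_XsubC => -[->]; rewrite -lt0n.
have [m ms mmax] : exists2 m, m \in s & {in s, forall x, x <= m}.
  elim: s s0 {sE} => // a [|b s] IHs _.
    by exists a; rewrite ?mem_head// => x; rewrite inE => /eqP->.
  have [//|m ms mmax] := IHs.
  exists (Num.max a m).
    by case: leP => _; rewrite inE ?eqxx// ms orbT.
  move=> x; rewrite in_cons le_max => /orP[/eqP->|/mmax->].
    by rewrite lexx.
  by rewrite orbT.
suff -> : spectral_radius R G = m by split=> [|x]; rewrite -sE//; exact: mmax.
have ubm : ubound [set x : R | eigenvalue A x]%classic m.
  by move=> x /=; rewrite -sE; exact: mmax.
apply/le_anti/andP; split.
  by apply: ge_sup => //; exists m; rewrite /= -sE.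
by apply: ub_le_sup; [exists m | rewrite /= -sE].
Qed.

End SpectralRadius.

(* Main.v *)
Require Import Defs.
From mathcomp Require Import all_boot all_order all_algebra.
From mathcomp Require Import boolp reals.
From mathcomp Require Import zify ring lra.
Import Order.TTheory GRing.Theory Num.Theory.
Set Implicit Arguments.
Unset Strict Implicit.
Unset Printing Implicit Defensive.

(** Let [lam] be the spectral radius of [G] and [n] its order. The absolute
    values [x] of an eigenvector, scaled to have maximum 1, satisfy
    [lam * x v <= \sum_(u in nbr v) x u], which serves in place of a Perron
    vector, as only upper bounds on [lam] are drawn from it
    ([sub_eigenvector]). Explicit eigenvectors of the extremal graphs turn the
    hypothesis into [g0 lam := lam ^+ 2 - (k - 1) * lam - k * (n - k) >= 0] in
    part (a), and into [(lam - 1) * g0 lam >= 2 * k] in part (b).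

    A missing broom makes [G] sparse: every subgraph has a vertex of bounded
    degree. Expanding [lam ^+ 2 * x z] at a vertex [z] with [x z = 1] over the
    walks of length 2 then shows that all but a small part of the weight
    reached lies on boundedly many vertices and that almost every vertex is
    adjacent to at least [k] of them. Two different sets of at least [k] such
    vertices, both containing [z] and both having many common neighbours,
    would contain every broom of order [2k + 3]. Hence there is one core [K]
    of [k] vertices of weight nearly 1 whose common neighbourhood [A] contains
    nearly all vertices ([dominating_set]).

    Around [K] a broom whose path has at most [2k + 1] vertices is found as
    soon as a neighbour of [K] outside [K] has a further neighbour outside
    [K]. If that never happens, then summing the eigenvector inequality over
    [K] gives [g0 lam <= 0], with equality only for [K] complete and joined to
    everything else, that is for [S_{n,k}] ([isolated_spectral],
    [isolated_extremal]). This settles (a), and all of (b) but the path on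
    [2k + 3] vertices. When that path is missing, the edges outside [K] that
    touch neighbours of [K] form stars centred there, and at most two vertices
    of [A] are touched. Each of the [d] vertices outside [K] and [A] costs a
    constant in the summed inequality, while the touched vertices of [A] gain
    only [O((1 + d) / lam)]; so [A] is the whole complement of [K], it spans
    exactly one edge, and comparing with the equation for [S_{n,k}^+] forces
    [K] to be complete ([pendant_extremal]). *)

(** * Embedding brooms *)

Definition nbr (G : sgraph) (v : G) : {set G} := [set u | adj v u].

Definition common_nbr (G : sgraph) (S : {set G}) : {set G} :=
  [set u | S \subset nbr u].

Section Brooms.
Variable G : sgraph.
Implicit Types (c v w : G) (p ls ks F : seq G) (A S K X Y : {set G}).

Lemma common_nbrP S w a : w \in S -> a \in common_nbr S -> adj w a.
Proof. by move=> wS; rewrite inE adj_sym => /subsetP/(_ w wS); rewrite inE. Qed.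

Lemma exists_outside S F : size F < #|S| -> exists2 v, v \in S & v \notin F.
Proof.
move=> FS; have /subsetPn[v vS vF] : ~~ (S \subset F).
  by apply/negP => /subset_leq_card/leq_trans/(_ (card_size F)); rewrite leqNgt FS.
by exists v.
Qed.

Lemma broom_of_seqs ls c p :
  uniq (ls ++ c :: p) -> all (adj c) ls -> path adj c p ->
  contains G (broom (size ls) (size p).+1).
Proof.
move=> U cls cp.
pose f (i : broom (size ls) (size p).+1) : G :=
  match i with inl i => nth c ls i | inr j => nth c (c :: p) j end.
pose g (i : broom (size ls) (size p).+1) : nat :=
  match i with inl i => i : nat | inr j => size ls + j end.
have fE i : f i = nth c (ls ++ c :: p) (g i).
  case: i => [[i /= il]|[j /= jl]]; rewrite nth_cat ?il //.
  by rewrite ltnNge leq_addr /= addKn.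
have g_lt i : g i < size (ls ++ c :: p).
  by rewrite size_cat /=; case: i => [[i il]|[j jl]] /=; lia.
have g_inj : injective g.
  case=> [i|i] [j|j] /= e; have := ltn_ord i; have := ltn_ord j => *;
    try lia; congr (_ _); apply/val_inj => /=; lia.
exists f; split=> [i j|].
  by rewrite !fE => /eqP; rewrite nth_uniq // => /eqP/g_inj.
have pE i : i < size p -> adj (nth c (c :: p) i) (nth c (c :: p) i.+1).
  by move/(pathP c) : cp => /(_ i) /[apply].
have aE i : i < size ls -> adj c (nth c ls i).
  by move=> il; move/allP: cls; apply; rewrite mem_nth.
case=> [i|i] [j|j] //=.
- by move=> /eqP->; rewrite adj_sym; apply/aE/ltn_ord.
- by move=> /eqP->; apply/aE/ltn_ord.
- have := ltn_ord i; have := ltn_ord j => jl il /orP[|] /eqP e.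
    by have := pE i; rewrite e; apply; lia.
  by have := pE j; rewrite e adj_sym; apply; lia.
Qed.

(** The leaves come for free at a centre of large degree, since the path uses
    up at most [t - 1] of its neighbours. *)
Lemma broom_of_path s t c p :
  path adj c p -> uniq (c :: p) -> 0 < t <= (size p).+1 ->
  s + t <= #|nbr c|.+1 -> contains G (broom s t).
Proof.
move=> cp U /andP[t0 tp] st.
pose q := take t.-1 p.
have sq : size q = t.-1 by rewrite size_take; case: ltnP => //; lia.
have /= /andP[cq Uq] : uniq (c :: q) by exact: (take_uniq t.-1.+1 U).
pose l := enum (nbr c :\: [set u in q]).
have sl : s <= size l.
  rewrite -cardE; have := cardsID [set u in q] (nbr c).
  have : #|nbr c :&: [set u in q]| <= size q.
    rewrite -[size q](card_uniqP Uq); apply/subset_leq_card/subsetP => u.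
    by rewrite !inE => /andP[].
  rewrite sq; lia.
have -> : s = size (take s l) by rewrite size_takel.
have -> : t = (size q).+1 by rewrite sq; lia.
apply: (@broom_of_seqs (take s l) c q).
- rewrite cat_uniq (take_uniq _ (enum_uniq _)) cons_uniq cq Uq !andbT /=.
  rewrite negb_or; apply/andP; split.
    by apply/negP => /mem_take; rewrite mem_enum !inE adj_irrefl andbF.
  apply/hasPn => u uq; apply/negP => /mem_take.
  by rewrite mem_enum !inE uq.
- by apply/allP => u /mem_take; rewrite mem_enum !inE => /andP[].
- exact: take_path.
Qed.

(** The path is grown greedily from its far end, so that the last vertex added
    is the centre. *)
Lemma broom_of_min_degree s t X : 0 < s -> 0 < t -> X != set0 ->
  (forall v, v \in X -> s + t <= #|nbr v :&: X|.+1) -> contains G (broom s t).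
Proof.
move=> s0 t0 X0 dX.
have [c [p [cX cp U sp]]] : exists c p,
    [/\ c \in X, path adj c p, uniq (c :: p) & size p = t.-1].
  have : t.-1 < s + t by lia.
  elim: t.-1 => [|j IHj] jst.
    by have /set0Pn[c cX] := X0; exists c, [::].
  have [|c [p [cX cp U sp]]] := IHj; first lia.
  have [|v] := @exists_outside (nbr c :&: X) p.
    have := dX c cX; lia.
  rewrite !inE => /andP[cv vX] vp; exists v, (c :: p); split => //.
  - by rewrite /= adj_sym cv.
  - rewrite cons_uniq U inE negb_or vp !andbT.
    by apply: contraTneq cv => ->; rewrite adj_irrefl.
  - by rewrite /= sp.
apply: broom_of_path cp U _ _; first lia.
by apply: leq_trans (dX c cX) _; rewrite ltnS subset_leq_card // subsetIl.
Qed.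

(** A path through prescribed vertices [c :: ks], any two consecutive ones being
    linked by a vertex of [A]; the set [F] is kept free for later use. *)
Lemma zigzag A F c ks :
  uniq (c :: ks) -> (forall w a, w \in c :: ks -> a \in A -> adj w a) ->
  size F + size ks <= #|A| ->
  exists p, [/\ path adj c p, uniq (c :: p), size p = (size ks).*2,
    last c p = last c ks &
    forall v, v \in p -> v \in ks \/ v \in A /\ v \notin F].
Proof.
elim: ks c F => [|d ks IHks] c F U cA szA; first by exists [::].
have Aks v : v \in c :: d :: ks -> v \notin A.
  by move=> /cA vA; apply/negP => /vA; rewrite adj_irrefl.
have [|a aA aF] := @exists_outside A F; first by move: szA => /=; lia.
have [|||p [dp Up sp lp pE]] := IHks d (a :: F).
- by case/andP: U.
- by move=> w b wd; apply: cA; rewrite inE wd orbT.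
- by move: szA => /=; lia.
exists (a :: d :: p); split => //=.
- by rewrite dp andbT cA ?mem_head // adj_sym cA // !inE eqxx orbT.
- have pks v : v \in p -> v \in ks \/ v \in A /\ v != a.
    by move=> /pE[|[vA]]; [left|rewrite inE negb_or => /andP[]; right].
  have ad : a \notin d :: p.
    rewrite inE negb_or; apply/andP; split.
      by apply: contraTneq aA => ->; apply: Aks; rewrite !inE eqxx orbT.
    apply/negP => /pks[aks|[_ /eqP//]].
    by move: aA; apply/negP/Aks; rewrite !inE aks !orbT.
  have cNA : c \notin A by apply: Aks; rewrite mem_head.
  move: Up ad U => /= -> -> /andP[]; rewrite !inE !negb_or => /andP[cd cks] _.
  rewrite cd !andbT; apply/andP; split.
    by apply: contraNneq cNA => ->.
  by apply/negP => /pks[cks'|[cA' _]]; [rewrite cks' in cks|rewrite cA' in cNA].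
- by rewrite sp doubleS.
- move=> v; rewrite !inE => /or3P[/eqP->|/eqP->|/pE[vks|[vA]]].
  + by right.
  + by rewrite eqxx; left.
  + by rewrite vks orbT; left.
  + by rewrite inE negb_or => /andP[]; right.
Qed.

Lemma zigzag_set K w F : w \in K -> size F + #|K| <= #|common_nbr K| ->
  exists c p, c \in K /\ [/\ path adj c p, uniq (c :: p), (size p).+2 = #|K|.*2,
    last c p = w &
    forall v, v \in c :: p -> v \in K \/ v \in common_nbr K /\ v \notin F].
Proof.
move=> wK szK.
pose l := rcons (enum (K :\ w)) w.
have lE v : (v \in l) = (v \in K).
  by rewrite mem_rcons inE mem_enum !inE; case: eqVneq => [->|].
have Ul : uniq l by rewrite rcons_uniq enum_uniq mem_enum !inE eqxx.
have sl : size l = #|K|.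
  by rewrite -(card_uniqP Ul); apply: eq_card => v; rewrite lE.
have ll c : last c l = w by rewrite last_rcons.
clearbody l; case: l => [|c ks] in lE Ul sl ll.
  by move: wK; rewrite -lE.
have [|||p [cp Up sp lp pE]] := @zigzag (common_nbr K) F c ks => //.
- by move=> u a; rewrite lE => uK aK; apply: common_nbrP uK aK.
- by move: sl szK => /=; lia.
exists c, p; split; first by rewrite -lE mem_head.
split=> //.
- by rewrite sp -sl doubleS.
- by rewrite lp -[RHS](ll w).
- move=> v; rewrite inE => /predU1P[->|/pE[vks|]]; last by right.
    by left; rewrite -lE mem_head.
  by left; rewrite -lE inE vks orbT.
Qed.

Lemma common_nbr_sub S v : v \in S -> common_nbr S \subset nbr v.
Proof. by move=> vS; apply/subsetP => a /(common_nbrP vS); rewrite inE. Qed.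

(** The centre lies in [K] and the path first exhausts [K], which provides
    [2 |K| - 1] vertices, then leaves [K] at a chosen vertex [w] along [q]. *)
Lemma broom_of_tail s t K w q : w \in K -> path adj w q -> uniq q ->
  {in q, forall v, v \notin K} -> 0 < t -> t < #|K|.*2 + size q ->
  s + t <= #|common_nbr K|.+1 -> size q + #|K| <= #|common_nbr K| ->
  contains G (broom s t).
Proof.
move=> wK wq Uq qK t0 tq st szq.
have [c [p [cK [cp Up sp lp pE]]]] := zigzag_set wK szq.
apply: (@broom_of_path _ _ c (p ++ q)).
- by rewrite cat_path cp lp.
- rewrite -cat_cons cat_uniq Up Uq andbT; apply/hasPn => v vq.
  by apply/negP => /pE[vK|[_]]; [move: (qK v vq); rewrite vK|rewrite vq].
- by rewrite size_cat; lia.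
- by apply: leq_trans st _; rewrite ltnS subset_leq_card // common_nbr_sub.
Qed.

(** The path exhausts [K], ending at the shared vertex [z], and goes on through
    the common neighbours of [S] to one more vertex of [S]. *)
Lemma broom_of_two_rich s t K S z : z \in K -> z \in S -> S != K ->
  #|K| <= #|S| -> 0 < t -> t <= #|K|.*2 + 2 ->
  s + t <= #|common_nbr K|.+1 -> #|K| + 3 <= #|common_nbr K| ->
  #|K| + 2 <= #|common_nbr S| -> contains G (broom s t).
Proof.
move=> zK zS SK KS t0 tK st mK mS.
have [w wS wK] : exists2 w, w \in S & w \notin K.
  apply/subsetPn; apply: contraNN SK => sSK.
  by rewrite eqEcard sSK.
have [|a aS aF] := @exists_outside (common_nbr S) (enum K).
  by rewrite -cardE; clear -mS; lia.
have [|b bS] := @exists_outside (common_nbr S) (a :: enum K).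
  by rewrite /= -cardE; clear -mS; lia.
rewrite inE negb_or !mem_enum in aF * => /andP[ba bF].
have NS u : u \in common_nbr S -> u \notin S.
  by move=> uS; apply/negP => /common_nbrP/(_ uS); rewrite adj_irrefl.
apply: (@broom_of_tail s t K z [:: a; w; b]) => //=.
- by rewrite (common_nbrP zS aS) adj_sym (common_nbrP wS aS) (common_nbrP wS bS).
- rewrite !inE negb_or eq_sym [a == b]eq_sym ba !andbT.
  apply/andP; split.
    by apply: contraTneq wS => ->; apply: NS.
  by apply: contraTneq wS => ->; apply: NS.
- by move=> v; rewrite !inE => /or3P[] /eqP->.
- by clear -tK; lia.
- by clear -mK; lia.
Qed.

(** The path on [2 |K| + 3] vertices that enters [K] through the first edge and
    leaves it through the second one; it is the broom with a single leaf. *)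
Lemma broom_of_two_edges t K a b a' b' :
  t = #|K|.*2 + 2 -> 1 < #|K| -> #|K| + 4 <= #|common_nbr K| ->
  a \in common_nbr K -> a' \in common_nbr K ->
  adj a b -> adj a' b' -> b \notin K -> b' \notin K ->
  uniq [:: a; b; a'; b'] -> contains G (broom 1 t).
Proof.
move=> tK K1 mK aK a'K ab ab' bK bK' U.
have [w wK] : exists w, w \in K by apply/card_gt0P; lia.
have [|c [p [cK [cp Up sp lp pE]]]] := @zigzag_set K w [:: a; b; a'; b'] wK.
  by move=> /=; clear -mK; lia.
have NK u : u \in common_nbr K -> u \notin K.
  by move=> uK; apply/negP => /common_nbrP/(_ uK); rewrite adj_irrefl.
have Np u : u \in [:: a; b; a'; b'] -> u \notin c :: p.
  move=> uF; apply/negP => /pE[|[_ /negP//]].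
  move: uF; rewrite !inE => /or4P[] /eqP->; apply/negP => //; exact: NK.
have -> : t = (size (c :: p ++ [:: a'; b'])).+1 by rewrite /= size_cat /=; clear -tK sp; lia.
apply: (@broom_of_seqs [:: b] a (c :: p ++ [:: a'; b'])).
- rewrite -cat_cons -[a :: c :: _]cat1s catA -cat_cons.
  rewrite (perm_uniq (s2 := [:: a; b; a'; b'] ++ c :: p)).
    rewrite cat_uniq U Up andbT andTb; apply/hasPn => v vp.
    by apply: contraL vp; apply: Np.
  apply/permP => P; rewrite /= !count_cat /=; ring.
- by rewrite /= ab.
- by rewrite /= cat_path cp lp /= ab' (common_nbrP wK a'K) adj_sym (common_nbrP cK aK).
Qed.

(** Removing a vertex of degree at most [d] from the subgraph induced on [X]
    lowers the degree sum by at most [2d]. *)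
Lemma sparse_of_degenerate d X :
  (forall Y, Y != set0 -> exists2 v, v \in Y & #|nbr v :&: Y| <= d) ->
  \sum_(u in X) #|nbr u :&: X| <= d.*2 * #|X|.
Proof.
move=> deg; have [m] := ubnP #|X|; elim: m X => // m IHm X Xm.
have [->|X0] := eqVneq X set0; first by rewrite big_set0.
have [v vX dv] := deg X X0.
have cX : #|X| = #|X :\ v|.+1 by rewrite (cardsD1 v) vX.
have {}IHm : \sum_(u in X :\ v) #|nbr u :&: (X :\ v)| <= d.*2 * #|X :\ v|.
  by apply: IHm; lia.
rewrite (bigD1 v) //= (eq_bigl [in X :\ v]); last first.
  by move=> u; rewrite !inE andbC.
have E u : u \in X :\ v ->
    #|nbr u :&: X| = adj v u + #|nbr u :&: (X :\ v)|.
  by move=> _; rewrite (cardsD1 v) -setIDA !inE vX andbT adj_sym.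
rewrite (eq_bigr _ E) big_split /=.
have -> : \sum_(u in X :\ v) (adj v u : nat) = #|nbr v :&: X|.
  rewrite -sum1_card big_mkcond [RHS]big_mkcond /=; apply: eq_bigr => u _.
  rewrite !inE; have [->|_] := eqVneq u v; first by rewrite adj_irrefl.
  by case: (adj v u); case: (u \in X).
rewrite cX; clear -IHm dv; lia.
Qed.

End Brooms.

Local Open Scope ring_scope.

(** * Vertices of large weight *)

Lemma card_bigcup_le (I T : finType) (P : pred I) (F : I -> {set T}) m :
  (forall i, P i -> (#|F i| <= m)%N) ->
  (#|\bigcup_(i | P i) F i| <= #|P| * m)%N.
Proof.
move=> Fm; rewrite -sum_nat_const.
apply: (@leq_trans (\sum_(i | P i) #|F i|)); last exact: leq_sum.
elim/big_rec2: _ => [|i a B Pi aB]; first by rewrite cards0.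
by apply: leq_trans (leq_card_setU _ _) _; rewrite leq_add2l.
Qed.

(** The eigenvector inequality [sub_x] is all that is kept of the eigenvector;
    [sparse] is the only consequence of the missing broom used here. *)
Section SubEigen.
Variables (R : realType) (G : sgraph) (x : G -> R) (lam : R) (c : nat).
Local Notation n := (#|G|%:R : R).
Hypothesis lam_gt0 : 0 < lam.
Hypothesis x_le1 : forall v, x v <= 1.
Hypothesis sub_x : forall v, lam * x v <= \sum_(u in nbr v) x u.
Hypothesis sparse :
  forall X : {set G}, (\sum_(u in X) #|nbr u :&: X| <= c * #|X|)%N.
Implicit Types (u v w z : G) (K L S X Y : {set G}) (a b : R).

Lemma sparse_pair X Y : (\sum_(u in X) #|nbr u :&: Y| <= c * (#|X| + #|Y|))%N.
Proof.
apply: (@leq_trans (\sum_(u in X :|: Y) #|nbr u :&: (X :|: Y)|)).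
  rewrite [leqRHS](bigID [in X]) /=; apply: leq_trans (leq_addr _ _).
  rewrite [leqRHS](eq_bigl [in X]); last first.
    by move=> u; rewrite inE; case: (u \in X); rewrite ?andbF.
  by apply: leq_sum => u _; rewrite subset_leq_card // setIS // subsetUr.
apply: leq_trans (sparse _) _; rewrite leq_mul2l leq_card_setU orbT //.
Qed.

Lemma sum_deg : \sum_(v : G) (#|nbr v|%:R : R) <= c%:R * n.
Proof.
have := sparse [set: G]; rewrite cardsT -(ler_nat R) natrM natr_sum.
apply: le_trans; rewrite (eq_bigl xpredT) => [|v]; last by rewrite inE.
by apply: ler_sum => v _; rewrite setIT.
Qed.

Lemma sum_le_card (A : {set G}) (f : G -> R) a : (forall v, v \in A -> f v <= a) ->
  \sum_(v in A) f v <= #|A|%:R * a.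
Proof. by move=> fa; rewrite mulr_natl -sumr_const ler_sum. Qed.

Definition level a : {set G} := [set v | a <= x v].

Lemma card_level a : #|level a|%:R * (a * lam) <= c%:R * n.
Proof.
apply: le_trans sum_deg; rewrite mulr_natl -sumr_const.
rewrite [leRHS](bigID [in level a]) /= -[leLHS]addr0 lerD ?sumr_ge0 //.
apply: ler_sum => v; rewrite inE => av.
have H : a * lam <= lam * x v by rewrite mulrC ler_pM2l.
apply: le_trans H (le_trans (sub_x v) _).
by rewrite -[leRHS]mulr1; apply: sum_le_card.
Qed.

(** Iterating the inequality counts weighted walks of length 2. *)
Lemma two_step_bound v : lam ^+ 2 * x v <= \sum_(u in nbr v) \sum_(w in nbr u) x w.
Proof.
rewrite expr2 -mulrA; apply: le_trans (_ : lam * \sum_(u in nbr v) x u <= _).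
  by rewrite ler_pM2l.
by rewrite mulr_sumr ler_sum.
Qed.

(** By sparsity the walks ending at a vertex of weight below [a] contribute
    at most [a * c * n]. *)
Lemma two_step_level_bound a v : 0 <= a ->
  lam ^+ 2 * x v <=
  a * (c%:R * n) + \sum_(u in nbr v) \sum_(w in nbr u :&: level a) x w.
Proof.
move=> a0; apply: le_trans (two_step_bound v) _.
apply: le_trans (_ : \sum_(u in nbr v) (a * #|nbr u|%:R +
   \sum_(w in nbr u :&: level a) x w) <= _); last first.
  rewrite big_split /= lerD2r -mulr_sumr ler_wpM2l //.
  apply: le_trans sum_deg; rewrite [leRHS](bigID [in nbr v]) /=.
  by rewrite lerDl sumr_ge0.
apply: ler_sum => u _; rewrite (bigID [in level a]) /= addrC lerD //; last first.
  by rewrite le_eqVlt; apply/orP; left; apply/eqP/eq_bigl => w; rewrite in_setI.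
rewrite mulr_natr -sumr_const [leRHS](bigID [in level a]) /=.
apply: ler_wpDl; first by rewrite sumr_ge0.
apply: ler_sum => w; rewrite inE => /andP[_]; rewrite inE -ltNge; exact: ltW.
Qed.

Lemma sum_indicator (A : {set G}) (b : pred G) :
  \sum_(u in A) ((b u)%:R : R) = #|[set u in A | b u]|%:R.
Proof.
rewrite -natr_sum -sum1_card big_mkcond [in RHS]big_mkcond /=; congr _%:R.
by apply: eq_bigr => u _; rewrite inE; case: (u \in A); case: (b u).
Qed.

Local Notation C := (c%:R : R).

(** A vertex of weight at least [a] sees weight [a * lam ^+ 2 >= a * n] at the
    end of its walks of length 2.  The vertices of the much lower level [b] are
    [O(sqrt n)] in number, so by sparsity these walks need a linear number of
    neighbours to pass through. *)
Lemma degree_of_level a v : 0 < C -> n <= lam ^+ 2 ->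
  C ^+ 5 * 16384 <= lam -> a * (32 * C) = 1 -> v \in level a ->
  n <= 64 * C ^+ 2 * #|nbr v|%:R.
Proof.
move=> C0 nlam Clam aC vL.
have a0 : 0 < a by rewrite -(@pmulr_lgt0 _ (32 * C)) ?aC // mulr_gt0.
(* With this [b] the walks ending below level [b] account for a quarter of
   [a * n] only. *)
pose b := 8 * a ^+ 2.
have b0 : 0 < b by rewrite mulr_gt0 // exprn_gt0.
have bC : b * C = a / 4.
  have -> : b * C = a * (a * (32 * C)) / 4 by rewrite /b; lra.
  by rewrite aC mulr1.
have blam : 128 * C ^+ 3 <= b * lam.
  have -> : 128 * C ^+ 3 = b * (C ^+ 5 * 16384).
    have -> : b * (C ^+ 5 * 16384) = 128 * C ^+ 3 * (a * (32 * C)) ^+ 2.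
      by rewrite /b; ring.
    by rewrite aC expr1n mulr1.
  by rewrite ler_pM2l.
have Lb : #|level b|%:R * C <= a / 4 * n.
  have H : #|level b|%:R * (128 * C ^+ 3) <= C * n.
    by apply: le_trans (card_level b); rewrite ler_wpM2l.
  have -> : a / 4 * n = a * (32 * C) * (C * n) / (128 * C ^+ 2).
    by field; rewrite gt_eqF.
  rewrite aC mul1r ler_pdivlMr; last by rewrite mulr_gt0 // exprn_gt0.
  by apply: le_trans H; rewrite le_eqVlt; apply/orP; left; apply/eqP; ring.
have S : a * n <= b * (C * n) + C * (#|nbr v|%:R + #|level b|%:R).
  have H1 : a * n <= lam ^+ 2 * x v.
    rewrite mulrC; apply: ler_pM; rewrite ?ler0n //; first exact: ltW.
    by rewrite inE in vL.
  apply: le_trans H1 (le_trans (two_step_level_bound _ (ltW b0)) _).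
  rewrite lerD2l.
  have := sparse_pair (nbr v) (level b).
  rewrite -(ler_nat R) natrM natrD natr_sum; apply: le_trans.
  apply: ler_sum => u _; rewrite -[leRHS]mulr1; exact: sum_le_card.
have H : a / 2 * n <= C * #|nbr v|%:R.
  rewrite mulrA bC mulrDr in S; lra.
have -> : n = a * (32 * C) * n by rewrite aC mul1r.
have -> : a * (32 * C) * n = 64 * C * (a / 2 * n) by lra.
have -> : 64 * C ^+ 2 * #|nbr v|%:R = 64 * C * (C * #|nbr v|%:R) by ring.
by rewrite ler_pM2l // mulr_gt0.
Qed.

(** The vertices of [level a] have linear degree while the degree sum is
    linear. *)
Lemma card_level_bounded a : 0 < C -> 0 < n -> n <= lam ^+ 2 ->
  C ^+ 5 * 16384 <= lam -> a * (32 * C) = 1 -> (#|level a| <= 64 * c ^ 3)%N.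
Proof.
move=> C0 n0 nlam Clam aC.
rewrite -(ler_nat R) -(ler_pM2r n0).
apply: le_trans (_ : 64 * C ^+ 2 * (C * n) <= _); last first.
  by rewrite natrM natrX le_eqVlt; apply/orP; left; apply/eqP; ring.
apply: le_trans (_ : 64 * C ^+ 2 * \sum_(v : G) (#|nbr v|%:R : R) <= _); last first.
  by rewrite ler_wpM2l ?sum_deg // mulr_ge0 // exprn_ge0 // ltW.
rewrite mulr_natl -sumr_const mulr_sumr [leRHS](bigID [in level a]) /=.
apply: ler_wpDr.
  by rewrite sumr_ge0 // => v _; rewrite mulr_ge0 // mulr_ge0 // exprn_ge0 // ltW.
by apply: ler_sum => v vL; apply: degree_of_level vL.
Qed.

End SubEigen.

(** * The dominating core *)

Lemma subset_of_card (T : finType) (S : {set T}) (z : T) k :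
  z \in S -> (0 < k <= #|S|)%N ->
  exists K : {set T}, [/\ z \in K, K \subset S & #|K| = k].
Proof.
move=> zS /andP[k0 kS]; pose l := take k (z :: enum (S :\ z)).
have sl : size l = k.
  by rewrite size_takel //= -cardE; rewrite (cardsD1 z) zS in kS.
have Ul : uniq l by rewrite take_uniq //= enum_uniq mem_enum !inE eqxx.
exists [set y in l]; split.
- by rewrite inE /l; case: k k0 {kS l sl Ul} => //= k _; rewrite mem_head.
- apply/subsetP => y; rewrite inE => /mem_take; rewrite inE mem_enum !inE.
  by case: eqVneq => [->|].
- by rewrite -[RHS]sl -(card_uniqP Ul); apply: eq_card => y; rewrite inE.
Qed.

Lemma common_nbrS (G : sgraph) (S K : {set G}) :
  K \subset S -> common_nbr S \subset common_nbr K.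
Proof. by move=> KS; apply/subsetP => u; rewrite !inE; apply: subset_trans. Qed.

(** [L] is the bounded set of heavy vertices and [P u] the set of heavy
    neighbours of [u].  A pattern [P u] is poor when fewer than [m] vertices are
    adjacent to all of it; boundedly many vertices have a poor pattern. *)
Section Dominating.
Variables (R : realType) (G : sgraph) (x : G -> R) (lam a : R) (c k s t l m : nat).
Local Notation n := (#|G|%:R : R).
Local Notation C := (c%:R : R).
Hypothesis lam_gt0 : 0 < lam.
Hypothesis x_le1 : forall v, x v <= 1.
Hypothesis sub_x : forall v, lam * x v <= \sum_(u in nbr v) x u.
Hypothesis sparse :
  forall X : {set G}, (\sum_(u in X) #|nbr u :&: X| <= c * #|X|)%N.
Hypotheses (k_gt0 : (0 < k)%N) (t_gt0 : (0 < t)%N) (tk : (t <= k.*2 + 2)%N).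
Hypotheses (mst : (s + t <= m.+1)%N) (mk : (k + 3 <= m)%N).
Hypothesis no_broom : ~ contains G (broom s t).
Hypothesis a01 : 0 < a <= 1.
Hypothesis card_L : (#|level x a| <= l)%N.
Variable z : G.
Hypothesis xz : x z = 1.

Let L := level x a.
Let P u := nbr u :&: L.
Let poor u := (#|common_nbr (P u)| < m)%N.
Let h u := \sum_(w in P u) x w.

Let uC u : u \in common_nbr (P u).
Proof. by rewrite inE subsetIl. Qed.

Let zP u : u \in nbr z -> z \in P u.
Proof.
rewrite !inE adj_sym => ->; rewrite xz; by case/andP: a01.
Qed.

Let h_card u : h u <= #|P u|%:R.
Proof. by rewrite -[leRHS]mulr1; apply: sum_le_card. Qed.

Let P_card u : (#|P u| <= l)%N.
Proof. by apply: leq_trans card_L; rewrite subset_leq_card // subsetIr. Qed.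

Let card_poor : (#|[set u | poor u]| <= 2 ^ l * m)%N.
Proof.
pose Q (S : {set G}) := (S \in powerset L) && (#|common_nbr S| < m)%N.
apply: (@leq_trans #|\bigcup_(S | Q S) common_nbr S|).
  apply/subset_leq_card/subsetP => u; rewrite inE => pu.
  apply/bigcupP; exists (P u) => //.
  by rewrite /Q powersetE subsetIr.
apply: leq_trans (@card_bigcup_le _ _ Q (@common_nbr G) m _) _.
  by move=> S /andP[_ /ltnW].
rewrite leq_mul2r; apply/orP; right.
apply: (@leq_trans #|powerset L|).
  by apply/subset_leq_card/subsetP => S; rewrite unfold_in => /andP[].
by rewrite card_powerset leq_exp2l.
Qed.

Let sum_h : lam ^+ 2 <= a * (C * n) + \sum_(u in nbr z) h u.
Proof.
have [a0 _] := andP a01.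
by have := two_step_level_bound lam_gt0 sub_x sparse z (ltW a0); rewrite xz mulr1.
Qed.

(* Bounds the total contribution of the neighbours with a poor pattern. *)
Let e : R := (2 ^ l * m * l)%:R.

(** A neighbour of [z] with a rich pattern contributes at most [k - 1], except
   for those in [B], which contribute at most [r] more. *)
Let sum_bound (B : {set G}) (r : R) :
  (forall u, u \in nbr z -> ~~ poor u ->
     h u <= (k%:R - 1) + (u \in B)%:R * r) ->
  0 <= r \/ B = set0 -> B \subset nbr z ->
  \sum_(u in nbr z) h u <= n * (k%:R - 1) + e + #|B|%:R * r.
Proof.
move=> hB rB BN.
have k1 : 0 <= k%:R - 1 :> R by rewrite subr_ge0 ler1n.
have r0 u : 0 <= (u \in B)%:R * r.
  by case: rB => [r0|->]; [rewrite mulr_ge0|rewrite inE mul0r].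
apply: le_trans (_ : \sum_(u in nbr z)
   ((k%:R - 1) + (poor u)%:R * l%:R + (u \in B)%:R * r) <= _).
  apply: ler_sum => u uz; case: (boolP (poor u)) => [pu|npu].
    rewrite mul1r; apply: ler_wpDr => //; apply: ler_wpDl => //.
    by apply: le_trans (h_card u) _; rewrite ler_nat P_card.
  by rewrite mul0r addr0; apply: hB.
rewrite big_split big_split /= -!mulr_suml !sum_indicator.
apply: lerD; last first.
  rewrite le_eqVlt; apply/orP; left; apply/eqP; congr (_%:R * _).
  apply: eq_card => u; rewrite inE; case: (boolP (u \in B)); rewrite ?andbF //.
  by move=> /(subsetP BN) ->.
apply: lerD.
  by rewrite sumr_const -[leLHS]mulr_natl ler_wpM2r // ler_nat max_card.
rewrite /e natrM ler_wpM2r // ler_nat; apply: leq_trans card_poor.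
by apply/subset_leq_card/subsetP => u; rewrite !inE => /andP[].
Qed.

(** The neighbours of [z] have to contribute nearly [k * n] in total.  Rich
    patterns of at least [k] vertices all coincide by [broom_of_two_rich], as
    they contain [z]; call this set [K].  The remaining neighbours of [z]
    contribute at most [k - 1] each, apart from a bounded error, so
    almost all vertices must have pattern [K], and the weight of [K]
    must be nearly [k]. *)
Lemma dominating_set : a * C * 32 <= 1 -> k%:R * (n - k%:R) <= lam ^+ 2 ->
  32 * (k%:R ^+ 2 + e) <= n ->
  exists K : {set G}, [/\ #|K| = k, (15 / 16) * n <= #|common_nbr K|%:R &
    k%:R - 1 / 16 <= \sum_(w in K) x w].
Proof.
move=> aC lam2 ne.
have k1 : 1 <= k%:R :> R by rewrite ler1n.
have e0 : 0 <= e by rewrite /e ler0n.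
have n0 : 0 < n by apply: lt_le_trans ne; nra.
have low : k%:R * n - k%:R ^+ 2 - n / 32 <= \sum_(u in nbr z) h u.
  have := sum_h; nra.
case: (pickP [pred u | [&& u \in nbr z, ~~ poor u & (k <= #|P u|)%N]]); last first.
  move=> none; have /(le_trans low) : \sum_(u in nbr z) h u <=
      n * (k%:R - 1) + e + #|set0 : {set G}|%:R * 0.
    apply: sum_bound => [u uz pu||]; [|by left|by rewrite sub0set].
    rewrite mulr0 addr0; apply: le_trans (h_card u) _.
    have := none u; rewrite inE /= uz pu /= => /negbT; rewrite -ltnNge => ku.
    by rewrite lerBrDr natr1 ler_nat.
  rewrite mulr0 addr0; nra.
move=> u0 /and3P[u0z rich0 k0].
have [|K [zK KP Kk]] := @subset_of_card _ (P u0) z k (zP u0z).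
  by rewrite k_gt0.
have mK : (m <= #|common_nbr K|)%N.
  rewrite /poor -leqNgt in rich0; apply: leq_trans rich0 _.
  by rewrite subset_leq_card // common_nbrS.
have uniqK u : u \in nbr z -> ~~ poor u -> (k <= #|P u|)%N -> P u = K.
  move=> uz; rewrite /poor -leqNgt => rich ku; apply/eqP/negPn/negP => PK.
  apply: no_broom; apply: (broom_of_two_rich zK (zP uz) PK) => //.
  - by rewrite Kk.
  - by rewrite Kk.
  - by clear -mst mK; lia.
  - by rewrite Kk; clear -mk mK; lia.
  - by rewrite Kk; clear -mk rich; lia.
pose B := [set u in nbr z | P u == K].
pose sK := \sum_(w in K) x w.
have sKk : sK <= k%:R by rewrite -Kk -[leRHS]mulr1; apply: sum_le_card.
have BC : (#|B| <= #|common_nbr K|)%N.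
  apply/subset_leq_card/subsetP => u; rewrite inE => /andP[_ /eqP <-].
  exact: uC.
exists K.
have [sk|sk] := lerP (k%:R - 1) sK; last first.
  have /(le_trans low) : \sum_(u in nbr z) h u <=
      n * (k%:R - 1) + e + #|set0 : {set G}|%:R * 0.
    apply: sum_bound => [u uz pu||]; [|by left|by rewrite sub0set].
    rewrite mulr0 addr0; have [ku|ku] := leqP k #|P u|.
      by rewrite /h uniqK // ltW.
    by apply: le_trans (h_card u) _; rewrite lerBrDr natr1 ler_nat.
  rewrite mulr0 addr0; nra.
have /(le_trans low) : \sum_(u in nbr z) h u <=
    n * (k%:R - 1) + e + #|B|%:R * (sK - (k%:R - 1)).
  apply: sum_bound => [u uz pu||].
- have [ku|ku] := leqP k #|P u|.
    have PK := uniqK _ uz pu ku.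
    by rewrite /B inE uz PK eqxx mul1r /h PK -/sK; lra.
  apply: ler_wpDr.
    by rewrite mulr_ge0 // subr_ge0.
  by apply: le_trans (h_card u) _; rewrite lerBrDr natr1 ler_nat.
- by left; rewrite subr_ge0.
- by apply/subsetP => u; rewrite inE => /andP[].
have Bn : #|B|%:R <= n by rewrite ler_nat max_card.
have B0 : 0 <= #|B|%:R :> R by [].
have BK : #|B|%:R <= #|common_nbr K|%:R :> R by rewrite ler_nat.
rewrite -/sK; set b := #|B|%:R in Bn B0 BK *; set kk := k%:R in k1 sk sKk ne *.
move=> H; have {}H : 15 / 16 * n <= b * (sK - (kk - 1)) by nra.
split=> //.
  apply: le_trans BK; apply: le_trans H _; rewrite -[leRHS]mulr1.
  by rewrite ler_wpM2l //; lra.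
have : 15 / 16 * n <= n * (sK - (kk - 1)).
  by apply: le_trans H _; rewrite ler_wpM2r // subr_ge0.
rewrite mulrC ler_pM2l //; lra.
Qed.
End Dominating.

(** * Weights around the core *)

(** The inequality [sub_x] is summed over [K]: a vertex [u] then enters with the
    coefficient [dK u], its number of neighbours in [K]. *)
Section Core.
Variables (R : realType) (G : sgraph) (x : G -> R) (lam : R) (k : nat).
Variable K : {set G}.
Local Notation n := (#|G|%:R : R).
Local Notation kR := (k%:R : R).
Local Notation A := (common_nbr K).
Hypothesis lam_gt0 : 0 < lam.
Hypothesis x_ge0 : forall v, 0 <= x v.
Hypothesis x_le1 : forall v, x v <= 1.
Hypothesis sub_x : forall v, lam * x v <= \sum_(u in nbr v) x u.
Hypothesis k_gt0 : (0 < k)%N.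
Hypothesis cardK : #|K| = k.
Hypothesis xK : forall w, w \in K -> 0 < x w.

Let dK v := #|nbr v :&: K|.
Let s := \sum_(w in K) x w.

Lemma core_deg_le v : (dK v <= k)%N.
Proof. by rewrite -cardK subset_leq_card // subsetIr. Qed.

Lemma core_deg_lt v : v \in K -> (dK v)%:R <= kR - 1.
Proof.
move=> vK; rewrite lerBrDr natr1 ler_nat -cardK; apply/proper_card/properP.
split; first exact: subsetIr.
by exists v => //; rewrite !inE adj_irrefl.
Qed.

Lemma core_weight_gt0 : 0 < s.
Proof.
have [w wK] : exists w, w \in K by apply/card_gt0P; rewrite cardK.
rewrite /s (bigD1 w) //=; apply: ltr_wpDr; last exact: xK.
by rewrite sumr_ge0.
Qed.

Lemma core_outside (f : G -> R) a : (forall u, u \notin K -> f u <= a) ->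
  \sum_(u | u \notin K) f u <= (n - kR) * a.
Proof.
move=> fa; have -> : n - kR = #|~: K|%:R.
  by rewrite -cardK -(cardsC K) natrD addrC addKr.
rewrite (eq_bigl [in ~: K]) => [|u]; last by rewrite inE.
by apply: sum_le_card => u; rewrite inE; apply: fa.
Qed.

Lemma core_indicator (B : {set G}) : (forall u, u \in B -> u \notin K) ->
  \sum_(u | u \notin K) ((u \in B)%:R : R) = #|B|%:R.
Proof.
move=> BK; rewrite (eq_bigl [in ~: K]) => [|u]; last by rewrite inE.
rewrite sum_indicator; congr _%:R; apply: eq_card => u; rewrite !inE.
by case: (boolP (u \in B)) => [/BK ->|]; rewrite ?andbF.
Qed.

Let F := \sum_(u in K) (kR - 1 - (dK u)%:R) * x u.

Lemma core_deficiency_ge0 : 0 <= F.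
Proof.
by rewrite sumr_ge0 // => u uK; rewrite mulr_ge0 // subr_ge0 core_deg_lt.
Qed.

Lemma core_clique : F = 0 -> {in K &, forall u v, u != v -> adj u v}.
Proof.
move=> F0 u v uK vK uv; have /eqP := F0.
rewrite psumr_eq0 => [/allP/(_ u (mem_index_enum u))|w wK]; last first.
  by rewrite mulr_ge0 // subr_ge0 core_deg_lt.
rewrite uK /= mulf_eq0 [x u == 0]gt_eqF ?xK // orbF subr_eq0 => /eqP du.
have : nbr u :&: K = K :\ u.
  apply/eqP; rewrite eqEcard; apply/andP; split.
    apply/subsetP => w; rewrite !inE => /andP[uw ->]; rewrite andbT.
    by apply: contraTneq uw => ->; rewrite adj_irrefl.
  rewrite -(ler_nat R) -/(dK u) -du lerBrDr natr1 ler_nat.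
  by rewrite -cardK (cardsD1 u K) uK.
by move/setP/(_ v); rewrite !inE vK andbT [v == u]eq_sym uv => ->.
Qed.

(** In the sum over [K], the vertices of [K] would contribute [(k - 1) * s] if
    [K] were a clique; [F] is what is lacking. *)
Lemma core_weight_bound : lam ^+ 2 * s <=
  lam * ((kR - 1) * s - F) + \sum_(u | u \notin K) (dK u)%:R * (lam * x u).
Proof.
have E : (kR - 1) * s - F = \sum_(u in K) (dK u)%:R * x u.
  rewrite /s /F mulr_sumr -sumrB; apply: eq_bigr => u _; ring.
have -> : \sum_(u | u \notin K) (dK u)%:R * (lam * x u) =
    lam * \sum_(u | u \notin K) (dK u)%:R * x u.
  by rewrite mulr_sumr; apply: eq_bigr => u _; ring.
have E2 : \sum_u (dK u)%:R * x u = \sum_(u in K) (dK u)%:R * x u +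
    \sum_(u | u \notin K) (dK u)%:R * x u by rewrite (bigID [in K]).
rewrite E -mulrDr -E2 expr2 -mulrA ler_pM2l //.
apply: le_trans (_ : \sum_(w in K) \sum_(u in nbr w) x u <= _).
  by rewrite /s mulr_sumr; apply: ler_sum.
rewrite (exchange_big_dep xpredT) //= le_eqVlt; apply/orP; left; apply/eqP.
apply: eq_bigr => u _; rewrite sumr_const mulr_natl; congr (_ *+ _).
by apply: eq_card => w; rewrite !inE unfold_in /= !inE andbC adj_sym.
Qed.

Lemma one_step_split v :
  lam * x v <= \sum_(u in nbr v :&: K) x u + \sum_(u in nbr v :\: K) x u.
Proof.
apply: le_trans (sub_x v) _; rewrite (bigID [in K]) /= lerD //.
  by rewrite le_eqVlt; apply/orP; left; apply/eqP/eq_bigl => u; rewrite in_setI.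
by rewrite le_eqVlt; apply/orP; left; apply/eqP/eq_bigl => u; rewrite in_setD andbC.
Qed.

Lemma sum_core_le v : \sum_(u in nbr v :&: K) x u <= s.
Proof.
rewrite /s [leRHS](bigID [in nbr v]) /= -[leLHS]addr0 lerD ?sumr_ge0 //.
by rewrite le_eqVlt; apply/orP; left; apply/eqP/eq_bigl => u; rewrite in_setI andbC.
Qed.

Lemma sum_core_le_deg v : \sum_(u in nbr v :&: K) x u <= (dK v)%:R.
Proof. by rewrite -[leRHS]mulr1; apply: sum_le_card. Qed.

Lemma core_joined v : dK v = k -> {in K, forall w, adj v w}.
Proof.
move=> dv w wK; have : nbr v :&: K = K.
  by apply/eqP; rewrite eqEcard subsetIr cardK -dv leqnn.
by move/setP/(_ w); rewrite !inE wK andbT.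
Qed.

Let attached v := (0 < dK v)%N.

(** Here the neighbours of [K] have no neighbour outside [K], as in [S_{n,k}]. *)
Section Isolated.
Hypothesis isolated : forall v b,
  v \notin K -> b \notin K -> attached v -> adj v b -> False.

Lemma isolated_bound v : v \notin K -> (dK v)%:R * (lam * x v) <= (dK v)%:R * s.
Proof.
move=> vK; case: (posnP (dK v)) => [->|dv]; first by rewrite !mul0r.
rewrite ler_pM2l ?ltr0n //; apply: le_trans (one_step_split v) _.
rewrite [X in _ + X]big1 => [|b]; first by rewrite addr0 sum_core_le.
by rewrite !inE => /andP[bK vb]; case: (isolated vK bK dv vb).
Qed.

Lemma isolated_spectral : lam ^+ 2 <= (kR - 1) * lam + kR * (n - kR).
Proof.
rewrite -(ler_pM2r core_weight_gt0); apply: le_trans core_weight_bound _.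
have H : \sum_(u | u \notin K) (dK u)%:R * (lam * x u) <= (n - kR) * (kR * s).
  apply: core_outside => u uK; apply: le_trans (isolated_bound uK) _.
  by rewrite ler_wpM2r ?ler_nat ?core_deg_le // ltW // core_weight_gt0.
have : 0 <= lam * F by rewrite mulr_ge0 ?core_deficiency_ge0 // ltW.
lra.
Qed.

(** Equality in [isolated_spectral] leaves no room for the deficiencies [F] of
    [K] and [F2] of the join between [K] and the rest. *)
Lemma isolated_extremal : (kR - 1) * lam + kR * (n - kR) <= lam ^+ 2 ->
  {in K &, forall u v, u != v -> adj u v} /\
  (forall v w, v \notin K -> w \in K -> adj v w).
Proof.
move=> lower; pose F2 := \sum_(u | u \notin K) (kR - (dK u)%:R).
have t0 u : 0 <= kR - (dK u)%:R :> R by rewrite subr_ge0 ler_nat core_deg_le.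
have F2_ge0 : 0 <= F2 by rewrite sumr_ge0.
have s0 := core_weight_gt0; have F_ge0 := core_deficiency_ge0.
have H : \sum_(u | u \notin K) (dK u)%:R * (lam * x u) <=
    (n - kR) * (kR * s) - F2 * s.
  have : \sum_(u | u \notin K) ((dK u)%:R * (lam * x u) + (kR - (dK u)%:R) * s)
      <= (n - kR) * (kR * s).
    apply: core_outside => u uK; have := isolated_bound uK; lra.
  by rewrite big_split /= -mulr_suml -/F2; lra.
have le1 : lam ^+ 2 * s >= ((kR - 1) * lam + kR * (n - kR)) * s.
  by rewrite ler_pM2r.
have lF : 0 <= lam * F by rewrite mulr_ge0 // ltW.
have sF : 0 <= F2 * s by rewrite mulr_ge0 // ltW.
have c := core_weight_bound.
have /eqP F0 : lam * F == 0 by rewrite eq_le lF andbT; lra.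
have /eqP F20 : F2 * s == 0 by rewrite eq_le sF andbT; lra.
split.
  apply: core_clique; apply/eqP.
  by move/eqP: F0; rewrite mulf_eq0 gt_eqF.
move=> v w vK; apply: core_joined.
move/eqP: F20; rewrite mulf_eq0 [s == 0]gt_eqF // orbF psumr_eq0 //.
move/allP/(_ v (mem_index_enum v)); rewrite vK /= subr_eq0 eqr_nat => /eqP <-.
by [].
Qed.

End Isolated.

(** The situation forced by the absence of a path on [2k + 3] vertices: no path
    of length 2 outside [K] starts at a neighbour of [K], and no two disjoint
    edges outside [K] start in [A].  The set [D] consists of the vertices
    outside [K] that miss some vertex of [K], and [Q] of the vertices of [A] with
    a neighbour outside [K]. *)
Section Pendant.
Hypothesis pendant : forall v b c, v \notin K -> b \notin K -> c \notin K ->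
  attached v -> adj v b -> adj b c -> c = v.
Hypothesis matching : forall a b a' b', a \in A -> b \notin K -> a' \in A ->
  b' \notin K -> adj a b -> adj a' b' -> ~~ uniq [:: a; b; a'; b'].
Hypothesis k_gt1 : (1 < k)%N.
Hypothesis core_heavy : kR - 1 / 16 <= s.
Let D := ~: (K :|: A).
Hypothesis lam_large : 4 * kR * (kR + 1) <= lam.
Hypothesis D_small : #|D|%:R * (4 * kR) <= lam ^+ 2.
Hypothesis lower : 2 * kR <= (lam - 1) * (lam ^+ 2 - (kR - 1) * lam - kR * (n - kR)).

Let out v := nbr v :\: K.
Let Q := [set a in A | out a != set0].

Let A_core a : a \in A -> a \notin K.
Proof. by move=> aA; apply/negP => /common_nbrP/(_ aA); rewrite adj_irrefl. Qed.

Let A_attached a : a \in A -> attached a.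
Proof.
move=> aA; have [w wK] : exists w, w \in K by apply/card_gt0P; rewrite cardK.
by apply/card_gt0P; exists w; rewrite !inE wK adj_sym (common_nbrP wK aA).
Qed.

(** Outside [K], an attached vertex is matched to an attached neighbour or is
    the centre of a star whose leaves see nothing else. *)
Lemma sum_out_cases v : v \notin K -> attached v ->
  lam * \sum_(b in out v) x b <= #|D|%:R * x v \/
  exists2 b, out v = [set b] & b \notin K /\ attached b.
Proof.
move=> vK av; case: (pickP [pred b in out v | attached b]) => [b|none].
  rewrite !inE /= => /andP[/andP[bK vb] ab]; right; exists b => //.
  apply/setP => c; rewrite !inE; apply/andP/eqP => [[cK vc]|->//].
  by apply: (pendant bK vK cK ab); rewrite // adj_sym.
left; rewrite mulr_sumr.
apply: le_trans (_ : #|out v|%:R * x v <= _).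
  apply: sum_le_card => b; rewrite !inE => /andP[bK vb].
  apply: le_trans (one_step_split b) _.
  have -> : nbr b :&: K = set0.
    apply/eqP; rewrite -cards_eq0 -leqn0 leqNgt; apply/negP => ab.
    by have := none b; rewrite !inE /= bK vb /= /attached /dK ab.
  rewrite big_set0 add0r; apply: le_trans (_ : \sum_(u in [set v]) x u <= _).
    rewrite [leRHS](bigID [in out b]) /= -[leLHS]addr0 lerD ?sumr_ge0 //.
    rewrite le_eqVlt; apply/orP; left; apply/eqP/eq_bigl => u.
    rewrite !inE; case: eqVneq => [->|uv] /=; first by rewrite vK adj_sym vb.
    apply/negbTE/negP => /andP[uK bu]; move/eqP: uv; apply.
    exact: (pendant vK bK uK av).
  by rewrite big_set1.
rewrite ler_wpM2r // ler_nat; apply/subset_leq_card/subsetP => b bv.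
have := none b; rewrite /= bv /= => /negbT nab; rewrite !inE negb_or.
move: bv; rewrite !inE => /andP[-> _] /=; apply/negP => bA.
by move/negP: nab; apply; apply: A_attached; rewrite inE.
Qed.

Lemma pendant_edge_bound v b : v \notin K -> attached b -> b \notin K ->
  out b = [set v] ->
  lam * x b <= s + x v.
Proof.
move=> vK ab bK ob; apply: le_trans (one_step_split b) _.
by rewrite lerD ?sum_core_le // -/(out b) ob big_set1.
Qed.

Lemma out_partner v b : v \notin K -> attached v -> out v = [set b] -> out b = [set v].
Proof.
move=> vK av ov; have /setP/(_ b) := ov.
rewrite !inE eqxx => /andP[bK vb].
apply/setP => c; rewrite !inE; apply/andP/eqP => [[cK bc]|->].
  exact: (pendant vK bK cK av vb bc).
by rewrite vK adj_sym.
Qed.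

Lemma out_bound v : v \notin K -> attached v -> (0 < #|D|)%N ->
  lam * \sum_(b in out v) x b <= kR + #|D|%:R * x v.
Proof.
move=> vK av D0; have Dx : x v <= #|D|%:R * x v.
  by rewrite -[leLHS]mul1r ler_wpM2r // ler1n.
have [H|[b ov [bK ab]]] := sum_out_cases vK av; first by apply: le_trans H _; rewrite lerDr.
rewrite ov big_set1; apply: le_trans (one_step_split b) _.
rewrite -/(out b) (out_partner vK av ov) big_set1 lerD //.
by apply: le_trans (sum_core_le_deg b) _; rewrite ler_nat core_deg_le.
Qed.

Let k2 : 2 <= kR. Proof. by rewrite ler_nat. Qed.

(** A vertex of [D] has at most [k - 1] neighbours in [K] and its neighbours
    outside [K] return only a small part of its own weight, hence
    [lam * x v <= k - 1 / 2]. *)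
Lemma deficient_vertex_loss v : v \in D -> (dK v)%:R * (lam * x v) <= kR * s - 1.
Proof.
move=> vD; have D0 : (0 < #|D|)%N by apply/card_gt0P; exists v.
have := vD; rewrite !inE negb_or => /andP[vK vA].
have ks : kR * (kR - 1 / 16) <= kR * s by rewrite ler_wpM2l.
have kk : kR * 2 <= kR * kR by rewrite ler_wpM2l // ler0n.
have [d0|d0] := posnP (dK v); first by rewrite d0 mul0r; have := k2; lra.
have dk : (dK v)%:R <= kR - 1.
  rewrite lerBrDr natr1 ler_nat ltn_neqAle core_deg_le andbT.
  apply: contra vA => /eqP /core_joined vK'.
  by apply/subsetP => w /vK'; rewrite inE.
have y0 : 0 <= lam * x v by rewrite mulr_ge0 // ltW.
have ob := out_bound vK d0 D0.
have y1 : lam ^+ 2 * x v <= lam * (kR - 1) + kR + #|D|%:R * x v.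
  have : lam * (lam * x v) <= lam * ((dK v)%:R + \sum_(b in out v) x b).
    rewrite ler_pM2l //; apply: le_trans (one_step_split v) _.
    by rewrite lerD2r sum_core_le_deg.
  have : lam * (dK v)%:R <= lam * (kR - 1) by rewrite ler_pM2l.
  lra.
have y2 : (4 * kR) * (#|D|%:R * x v) <= lam ^+ 2 * x v.
  by rewrite mulrA [4 * kR * _]mulrC ler_wpM2r.
have y : lam * x v <= kR - 1 / 2.
  rewrite -(ler_pM2l lam_gt0) mulrA -expr2; set X := lam ^+ 2 * x v in y1 y2 *.
  have y3 : 4 * kR * X - X <= 4 * kR * (lam * (kR - 1) + kR).
    have : 4 * kR * X <= 4 * kR * (lam * (kR - 1) + kR + #|D|%:R * x v).
      by rewrite ler_wpM2l // mulr_ge0.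
    lra.
  rewrite -(ler_pM2l (_ : 0 < 4 * kR - 1)); last by have := k2; lra.
  apply: le_trans (_ : 4 * kR * (lam * (kR - 1) + kR) <= _); first lra.
  have : lam * 2 <= lam * kR by rewrite ler_pM2l.
  have := k2; have := lam_large; have := lam_gt0; lra.
apply: le_trans (_ : (kR - 1) * (kR - 1 / 2) <= _); first exact: ler_pM.
nra.
Qed.

(** Two vertices of [Q] must be adjacent, for otherwise their edges outside [K]
    are disjoint or form a path of length 2.  Three pairwise
    adjacent ones would form such a path as well. *)
Lemma card_active_le2 : (#|Q| <= 2)%N.
Proof.
rewrite leqNgt; apply/negP => /card_gt2P[a [b [c [[aQ bQ cQ] [ab bc ca]]]]].
have adjQ u v : u \in Q -> v \in Q -> u != v -> adj u v.
  rewrite inE => /andP[uA /set0Pn[u' uu']]; rewrite inE => /andP[vA /set0Pn[v' vv']] uv.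
  move: uu' vv'; rewrite !inE => /andP[u'K uu'] /andP[v'K vv'].
  have := matching uA u'K vA v'K uu' vv'.
  rewrite /= !inE !negb_or uv /= !andbT.
  case: eqVneq => [e|_]; first by rewrite -e adj_irrefl in uu'.
  case: eqVneq => [e|_]; first by rewrite e adj_sym.
  case: eqVneq => [e|_]; first by rewrite -e.
  case: eqVneq => [e|_] /=.
    move=> _; case/eqP: uv; apply/esym.
    apply: (pendant (A_core uA) u'K (A_core vA) (A_attached uA) uu').
    by rewrite e adj_sym.
  by case: eqVneq => // e; rewrite -e adj_irrefl in vv'.
have QK u : u \in Q -> u \notin K by rewrite inE => /andP[/A_core].
have Qa u : u \in Q -> attached u by rewrite inE => /andP[/A_attached].
have := pendant (QK _ aQ) (QK _ bQ) (QK _ cQ) (Qa _ aQ)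
  (adjQ _ _ aQ bQ ab) (adjQ _ _ bQ cQ bc).
by move/eqP: ca.
Qed.

Lemma lam_gt1 : 0 < lam - 1.
Proof.
have kk : kR * 2 <= kR * kR by rewrite ler_wpM2l // ler0n.
have := lam_large; have := k2; lra.
Qed.

Lemma lower_gt0 : 0 < lam ^+ 2 - (kR - 1) * lam - kR * (n - kR).
Proof.
rewrite -(pmulr_rgt0 _ lam_gt1); have := lower; have := k2; lra.
Qed.

(** The constant loss at every vertex of [D] outweighs the gain of at most
    [k * (k + |D|) / lam] at each of the two vertices of [Q]. *)
Lemma no_deficient_vertex : D = set0.
Proof.
apply/eqP; rewrite -cards_eq0 -leqn0 leqNgt; apply/negP => D0.
pose q := kR * (kR + #|D|%:R) / lam.
have q0 : 0 <= q.
  by rewrite /q divr_ge0 ?(ltW lam_gt0) // mulr_ge0 // addr_ge0.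
have D1 : 1 <= #|D|%:R :> R by rewrite ler1n.
have q2 : 2 * q <= #|D|%:R / 2.
  rewrite /q mulrA ler_pdivrMr //.
  have : #|D|%:R * (4 * kR * (kR + 1)) <= #|D|%:R * lam by rewrite ler_wpM2l.
  nra.
have H : \sum_(u | u \notin K) ((dK u)%:R * (lam * x u) + (u \in D)%:R -
    (u \in Q)%:R * q) <= (n - kR) * (kR * s).
  apply: core_outside => u uK.
  have [uD|uD] := boolP (u \in D).
    have -> : (u \in Q) = false.
      apply/negbTE/negP; rewrite inE => /andP[uA _].
      by move: uD; rewrite inE in_setU uA orbT.
    have := deficient_vertex_loss uD; rewrite mul0r /=; lra.
  have uA : u \in A by move: uD; rewrite inE negbK in_setU (negbTE uK).
  rewrite addr0.
  have du : dK u = k.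
    by rewrite -cardK /dK; apply: eq_card => w; rewrite in_setI; apply: andb_idl;
      move: uA; rewrite inE => /subsetP/(_ w).
  rewrite du; have b := one_step_split u.
  have sK := sum_core_le u.
  have [uQ|uQ] := boolP (u \in Q).
    have ob := out_bound uK (A_attached uA) D0.
    have {}ob : \sum_(b in out u) x b <= (kR + #|D|%:R) / lam.
      rewrite ler_pdivlMr // mulrC; apply: le_trans ob _.
      by rewrite lerD2l -[leRHS]mulr1 ler_wpM2l.
    have : kR * (lam * x u) <= kR * (s + (kR + #|D|%:R) / lam).
      rewrite ler_wpM2l //; apply: le_trans b _; exact: lerD.
    by rewrite mulrDr mul1r /q -mulrA lerBlDr.
  have o0 : out u = set0.
    by move: uQ; rewrite inE uA /= negbK => /eqP.
  rewrite mul0r subr0 ler_wpM2l //; apply: le_trans b _.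
  by rewrite -/(out u) o0 big_set0 addr0.
have E : \sum_(u | u \notin K) ((dK u)%:R * (lam * x u) + (u \in D)%:R -
    (u \in Q)%:R * q) = \sum_(u | u \notin K) (dK u)%:R * (lam * x u) +
    #|D|%:R - #|Q|%:R * q.
  rewrite sumrB big_split /= -mulr_suml.
  rewrite !core_indicator // => u; rewrite inE.
    by case/andP => /A_core.
  by rewrite in_setU negb_or => /andP[].
rewrite E in H.
have qQ : #|Q|%:R * q <= 2 * q by rewrite ler_wpM2r // ler_nat card_active_le2.
have lF : 0 <= lam * F by rewrite mulr_ge0 ?core_deficiency_ge0 // ltW.
have c := core_weight_bound; have s0 := core_weight_gt0.
have : 0 < (lam ^+ 2 - (kR - 1) * lam - kR * (n - kR)) * s.
  by rewrite mulr_gt0 // lower_gt0.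
lra.
Qed.

(** Without any edge outside [K] the bound [isolated_spectral] contradicts
    [lower].  With an edge [a b], the weights satisfy
    [(lam - 1) * (x a + x b) <= 2 * s], and substituting this in
    [core_weight_bound] leaves no room for the deficiency [F]. *)
Lemma pendant_extremal : exists a b : G,
  [/\ a \notin K, b \notin K & adj a b] /\
  [/\ {in K &, forall u v, u != v -> adj u v},
      (forall v w, v \notin K -> w \in K -> adj v w) &
      forall u v, u \notin K -> v \notin K -> adj u v -> u = a \/ u = b].
Proof.
have inA u : u \notin K -> u \in A.
  move=> uK; have /setP/(_ u) := no_deficient_vertex.
  by rewrite in_setC in_setU (negbTE uK) in_set0 => /negbFE.
have joined v w : v \notin K -> w \in K -> adj v w.
  by move=> /inA vA wK; rewrite adj_sym (common_nbrP wK vA).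
have l0 := lower_gt0.
case: (pickP [pred p : G * G | [&& p.1 \notin K, p.2 \notin K & adj p.1 p.2]]).
  move=> [a b] /= /and3P[aK bK ab].
  have oa : out a = [set b].
    apply/setP => c; rewrite !inE; apply/andP/eqP => [[cK ac]|-> //].
    by apply: (pendant bK aK cK (A_attached (inA _ bK))); rewrite // adj_sym.
  have ob := out_partner aK (A_attached (inA _ aK)) oa.
  have other u v : u \notin K -> v \notin K -> adj u v -> u = a \/ u = b.
    move=> uK vK uv; have [|ua] := eqVneq u a; first by left.
    have [|ub] := eqVneq u b; first by right.
    have := matching (inA _ aK) bK (inA _ uK) vK ab uv.
    rewrite /= !inE !negb_or [a == u]eq_sym [b == u]eq_sym ua ub /= !andbT.
    case: eqVneq => [e|_]; first by rewrite -e adj_irrefl in ab.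
    case: eqVneq => [e|_] /=.
      have /setP/(_ u) := oa; rewrite !inE uK e adj_sym uv (negbTE ub).
      by [].
    case: eqVneq => [e|_] /=.
      have /setP/(_ u) := ob; rewrite !inE uK e adj_sym uv (negbTE ua).
      by [].
    by case: eqVneq => // e; rewrite -e adj_irrefl in uv.
  exists a, b; split=> //; split=> //.
  apply: core_clique; apply/eqP.
  have abN : a != b by apply: contraTneq ab => ->; rewrite adj_irrefl.
  have dk u : u \notin K -> dK u = k.
    move=> uK; rewrite -cardK /dK; apply: eq_card => w; rewrite !inE.
    by apply: andb_idl => wK; apply: joined.
  have xa := pendant_edge_bound bK (A_attached (inA _ aK)) aK oa.
  have xb := pendant_edge_bound aK (A_attached (inA _ bK)) bK ob.
  have s0 := core_weight_gt0; have F0 := core_deficiency_ge0.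
  pose ca := kR * (lam * x a - s); pose cb := kR * (lam * x b - s).
  have H : \sum_(u | u \notin K) ((dK u)%:R * (lam * x u) -
      (u \in [set a])%:R * ca - (u \in [set b])%:R * cb) <= (n - kR) * (kR * s).
    apply: core_outside => u uK; rewrite !inE (dk _ uK).
    have [->|ua] := eqVneq u a; first by rewrite (negbTE abN) mul1r mul0r /ca; lra.
    have [->|ub] := eqVneq u b; first by rewrite mul0r mul1r /cb; lra.
    rewrite !mul0r !subr0 ler_wpM2l //; apply: le_trans (one_step_split u) _.
    rewrite [X in _ + X]big1 => [|v]; first by rewrite addr0 sum_core_le.
    rewrite !inE => /andP[vK uv]; case: (other _ _ uK vK uv) => e.
      by rewrite e eqxx in ua.
    by rewrite e eqxx in ub.
  rewrite !sumrB -!mulr_suml !core_indicator ?cards1 in H; last first.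
  - by move=> u /set1P->.
  - by move=> u /set1P->.
  have c := core_weight_bound.
  have l1 := lam_gt1.
  have lF : 0 <= (lam - 1) * (lam * F) by rewrite !mulr_ge0 ?(ltW l1) ?(ltW lam_gt0).
  have T1 : lam ^+ 2 * s - lam * (kR - 1) * s - (n - kR) * kR * s + lam * F <=
      kR * lam * (x a + x b) - 2 * kR * s by rewrite /ca /cb in H; lra.
  have T2 := ler_wpM2l (ltW l1) T1.
  have T3 : kR * lam * ((lam - 1) * (x a + x b)) <= kR * lam * (2 * s).
    by rewrite ler_wpM2l ?mulr_ge0 ?(ltW lam_gt0) //; lra.
  have T4 := ler_wpM2r (ltW s0) lower.
  have : (lam - 1) * (lam * F) == 0 by rewrite eq_le lF andbT; lra.
  by rewrite !mulf_eq0 (gt_eqF l1) (gt_eqF lam_gt0).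
move=> none; have iso : lam ^+ 2 <= (kR - 1) * lam + kR * (n - kR).
  apply: isolated_spectral => v b vK bK _ vb.
  by have := none (v, b); rewrite /= vK bK vb.
lra.
Qed.

End Pendant.

End Core.

(** * Spectral radii of the extremal graphs *)

Section Spectral.
Variables (R : realType).

Lemma sum_enum_val (G : sgraph) (F : G -> R) :
  \sum_u F u = \sum_(i < graph_order G) F (enum_val i).
Proof.
rewrite (reindex (@enum_val G (mem G))) //=.
by exists enum_rank => i _; rewrite ?enum_valK ?enum_rankK.
Qed.

Lemma eigenvalue_of_fun (G : sgraph) (f : G -> R) lam v0 : f v0 != 0 ->
  (forall v, lam * f v = \sum_(u in nbr v) f u) -> eigenvalue (adjmx R G) lam.
Proof.
move=> f0 fE; apply/eigenvalueP; exists (\row_i f (enum_val i)).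
  apply/rowP => j; rewrite !mxE fE.
  under eq_bigr do rewrite !mxE.
  rewrite [RHS]big_mkcond [RHS]sum_enum_val; apply: eq_bigr => u _.
  by rewrite inE adj_sym; case: adj; rewrite ?mulr1 ?mulr0.
apply/eqP => /rowP/(_ (enum_rank v0)); rewrite !mxE enum_rankK.
by move/eqP; rewrite (negbTE f0).
Qed.

Lemma fun_of_eigenvalue (G : sgraph) (lam : R) : eigenvalue (adjmx R G) lam ->
  exists f : G -> R, (exists v, f v != 0) /\
    forall v, lam * f v = \sum_(u in nbr v) f u.
Proof.
move=> /eigenvalueP[v vA v0]; exists (fun u => v 0 (enum_rank u)); split.
  have /rV0Pn[i vi] := v0; exists (enum_val i); by rewrite enum_valK.
move=> u; have /rowP/(_ (enum_rank u)) := vA; rewrite !mxE => <-.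
under eq_bigr do rewrite !mxE.
rewrite [RHS]big_mkcond [RHS]sum_enum_val; apply: eq_bigr => i _.
rewrite enum_valK enum_rankK inE adj_sym.
by case: adj; rewrite ?mulr1 ?mulr0.
Qed.

Lemma eigenvalue_le_radius (G : sgraph) (lam : R) (v0 : G) :
  eigenvalue (adjmx R G) lam -> lam <= spectral_radius R G.
Proof.
have [|_] := @spectral_radius_max R G; last by apply.
by apply/card_gt0P; exists v0.
Qed.

(** Taking absolute values in the eigenvalue equation yields an inequality that
    is as good as a nonnegative eigenvector for bounding [lam] from above. *)
Lemma sub_eigenvector (G : sgraph) : (0 < graph_order G)%N ->
  exists (x : G -> R) (z : G), [/\ forall v, 0 <= x v, forall v, x v <= 1,
    x z = 1 &
    forall v, spectral_radius R G * x v <= \sum_(u in nbr v) x u].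
Proof.
move=> /(@spectral_radius_max R)[/fun_of_eigenvalue[f [[v0 f0] fE]] _].
pose z := [arg max_(v > v0) `|f v|]%O.
have zP v : `|f v| <= `|f z|.
  by rewrite /z; case: arg_maxP => // i _ /(_ v); apply.
have fz : 0 < `|f z| by apply: lt_le_trans (zP v0); rewrite normr_gt0.
exists (fun v => `|f v| / `|f z|), z; split=> [v|v||v].
- by rewrite divr_ge0.
- by rewrite ler_pdivrMr // mul1r.
- by rewrite divff // gt_eqF.
rewrite mulrA -mulr_suml ler_pM2r ?invr_gt0 //.
apply: le_trans (_ : `|\sum_(u in nbr v) f u| <= _); last exact: ler_norm_sum.
by rewrite -fE normrM ler_wpM2r // ler_norm.
Qed.

Lemma sum_const_ord (m : nat) (a : R) : \sum_(i < m) a = m%:R * a.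
Proof. by rewrite sumr_const card_ord mulr_natl. Qed.

Lemma sum_neq_ord (m : nat) (i : 'I_m) (a : R) :
  \sum_(j < m) (if i != j then a else 0) = (m%:R - 1) * a.
Proof.
rewrite -big_mkcond /= mulrBl mul1r -[in RHS]sum_const_ord [in RHS](bigD1 i) //=.
rewrite addrAC subrr add0r; by apply: eq_bigl => j; rewrite eq_sym.
Qed.

Lemma nbr_sum (G : sgraph) (v : G) (f : G -> R) :
  \sum_(u in nbr v) f u = \sum_u if adj v u then f u else 0.
Proof. by rewrite big_mkcond; apply: eq_bigr => u _; rewrite inE. Qed.

(** The eigenvector is constant on the clique and on the independent set. *)
Lemma S_graph_eigenvalue (n k : nat) (th : R) : (0 < k < n)%N ->
  th ^+ 2 = (k%:R - 1) * th + k%:R * (n%:R - k%:R) ->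
  eigenvalue (adjmx R (S_graph n k)) th.
Proof.
move=> /andP[k0 kn] thE.
pose f (v : S_graph n k) : R := if v is inl _ then th else k%:R.
have nk : (0 < n - k)%N by rewrite subn_gt0.
apply: (@eigenvalue_of_fun _ f th (inr (Ordinal nk))).
  by rewrite /f pnatr_eq0 -lt0n.
have nkE : (n - k)%:R = n%:R - k%:R :> R by rewrite natrB // ltnW.
case=> [i|i]; rewrite nbr_sum big_sumType /=.
  rewrite sum_neq_ord sum_const_ord nkE -expr2 thE; ring.
by rewrite sum_const_ord big1 // addr0 mulrC.
Qed.

Lemma S_graph_radius (n k : nat) (lam : R) : (0 < k < n)%N ->
  spectral_radius R (S_graph n k) <= lam ->
  0 < lam /\ (k%:R - 1) * lam + k%:R * (n%:R - k%:R) <= lam ^+ 2.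
Proof.
move=> /andP[k0 kn] mulam.
have k1 : 1 <= k%:R :> R by rewrite ler1n.
have nk1 : 1 <= n%:R - k%:R :> R by rewrite lerBrDr addrC natr1 ler_nat.
pose d : R := (k%:R - 1) ^+ 2 + 4 * (k%:R * (n%:R - k%:R)).
have kn1 : 1 <= k%:R * (n%:R - k%:R) :> R by nra.
have d0 : 0 < d by rewrite /d; nra.
pose th := (k%:R - 1 + Num.sqrt d) / 2.
have thE : th ^+ 2 = (k%:R - 1) * th + k%:R * (n%:R - k%:R).
  have := sqr_sqrtr (ltW d0); rewrite /th {2}/d; nra.
have sq0 : 0 < Num.sqrt d by rewrite sqrtr_gt0.
have sqk : k%:R - 1 <= Num.sqrt d.
  have : Num.sqrt ((k%:R - 1) ^+ 2) <= Num.sqrt d by rewrite ler_wsqrtr // /d; lra.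
  by rewrite sqrtr_sqr ger0_norm // subr_ge0.
have thlam : th <= lam.
  apply: le_trans mulam; apply: (@eigenvalue_le_radius (S_graph n k) _ (inl (Ordinal k0))).
  by apply: S_graph_eigenvalue => //; rewrite k0.
have th0 : 0 < th by rewrite /th; lra.
split; first exact: lt_le_trans thlam.
have th1 : k%:R - 1 <= th by rewrite /th; lra.
have : 0 <= (lam - th) * (lam + th - (k%:R - 1)) by rewrite mulr_ge0; lra.
lra.
Qed.

Lemma sum_two_ord (m : nat) (a b : R) : (1 < m)%N ->
  \sum_(i < m) (if (i < 2)%N then a else b) = 2 * a + (m%:R - 2) * b.
Proof.
case: m => [|[|m]] // _; rewrite !big_ord_recl /= sum_const_ord -!natr1; ring.
Qed.

(** The eigenvector takes the value [th * (th - 1)] on the clique, [k * th] at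
    the ends of the added edge and [k * (th - 1)] elsewhere. *)
Lemma Splus_graph_eigenvalue (n k : nat) (th : R) : (0 < k)%N -> (k + 2 <= n)%N ->
  0 < th ->
  2 * k%:R = (th - 1) * (th ^+ 2 - (k%:R - 1) * th - k%:R * (n%:R - k%:R)) ->
  eigenvalue (adjmx R (Splus_graph n k)) th.
Proof.
move=> k0 kn th0 thE.
pose f (v : Splus_graph n k) : R := match v with
  | inl _ => th * (th - 1)
  | inr i => if (i < 2)%N then k%:R * th else k%:R * (th - 1) end.
have nk : (0 < n - k)%N by lia.
apply: (@eigenvalue_of_fun _ f th (inr (Ordinal nk))).
  by rewrite /f /= mulf_neq0 // ?gt_eqF // ltr0n.
have nkE : (n - k)%:R = n%:R - k%:R :> R by rewrite natrB //; lia.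
have nk2 : (1 < n - k)%N by lia.
case=> [i|i]; rewrite nbr_sum big_sumType /=.
  under eq_bigr do rewrite /Splus_adj /= orbF.
  rewrite sum_neq_ord sum_two_ord // nkE; lra.
rewrite sum_const_ord.
have -> : \sum_(j < n - k) (if @Splus_adj n k (inr i) (inr j) then
    if (j < 2)%N then k%:R * th else k%:R * (th - 1) else 0) =
    if (i < 2)%N then k%:R * th else 0.
  rewrite /Splus_adj /=; move: i (nk2); case: (n - k)%N => [|[|m]] // i _.
  rewrite !big_ord_recl big1 ?addr0 => [|j _].
    by case: i => [[|[|i]] ?] /=; rewrite ?addr0 ?add0r.
  by rewrite !andbF.
by case: ifP => _; ring.
Qed.

(** If the cubic were negative at [lam], or at 2 when [lam < 2], the intermediate
    value theorem would give it a larger root, which is an eigenvalue. *)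
Lemma Splus_graph_radius (n k : nat) (lam : R) : (0 < k)%N -> (k + 5 <= n)%N ->
  spectral_radius R (Splus_graph n k) <= lam ->
  2 <= lam /\
  2 * k%:R <= (lam - 1) * (lam ^+ 2 - (k%:R - 1) * lam - k%:R * (n%:R - k%:R)).
Proof.
move=> k0 kn mulam; set kR : R := k%:R; set nR : R := n%:R.
have k1 : 1 <= kR by rewrite /kR ler1n.
have nk5 : 5 <= nR - kR by rewrite lerBrDr addrC -natrD ler_nat.
pose p : {poly R} := ('X - 1) *
  ('X^2 - (kR - 1) *: 'X - (kR * (nR - kR))%:P) - (2 * kR)%:P.
have pE t : p.[t] = (t - 1) * (t ^+ 2 - (kR - 1) * t - kR * (nR - kR)) - 2 * kR.
  by rewrite /p !hornerE.
have key t : 2 <= t -> lam <= t -> 0 <= p.[t].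
  move=> t2 tlam; rewrite leNgt; apply/negP => pt.
  (* Any point where the cubic is visibly nonnegative would do. *)
pose b := t + nR + kR.
  have pb : 0 <= p.[b].
    have b2 : 1 <= b - 1 by rewrite /b; lra.
    have bn : kR * (nR - kR) + 2 * kR <= b * (b - (kR - 1)).
      have : (kR + 2) * nR <= b * (b - (kR - 1)) by rewrite ler_pM // /b; lra.
      nra.
    rewrite pE; nra.
  have [||th /andP[tth _] /rootP pth] := @poly_ivt R p t b.
  - by rewrite /b; lra.
  - by rewrite (ltW pt).
  have th_gt : t < th.
    by rewrite lt_neqAle tth andbT; apply: contraTneq pt => ->; rewrite pth ltxx.
  have : th <= spectral_radius R (Splus_graph n k).
    apply: (@eigenvalue_le_radius (Splus_graph n k) _ (inl (Ordinal k0))).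
    apply: Splus_graph_eigenvalue => //; [lia|lra|].
    by move: pth; rewrite pE -/kR -/nR; lra.
  lra.
have lam2 : 2 <= lam.
  rewrite leNgt; apply/negP => lam2.
  have := key 2 (lexx _) (ltW lam2); rewrite pE; nra.
split=> //; have := key lam lam2 (lexx _); rewrite pE; lra.
Qed.
End Spectral.

(** * Recognising the extremal graphs *)

Section Recognition.
Variables (G : sgraph) (k : nat) (K : {set G}) (l : seq G) (z : G).
Hypothesis cardK : #|K| = k.
Hypothesis Ul : uniq l.
Hypothesis lE : forall v, (v \in l) = (v \notin K).
Hypothesis clique : {in K &, forall u v, u != v -> adj u v}.
Hypothesis joined : forall v w, v \notin K -> w \in K -> adj v w.

Definition layout (i : 'I_k + 'I_(graph_order G - k)) : G :=
  match i with inl i => nth z (enum K) i | inr j => nth z l j end.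

Lemma size_layout : size l = (graph_order G - k)%N.
Proof.
rewrite -(card_uniqP Ul) /graph_order -(cardsC K) cardK addKn.
by apply: eq_card => v; rewrite lE inE.
Qed.

Lemma layout_inl i : layout (inl i) \in K.
Proof. by rewrite -mem_enum mem_nth // -cardE cardK. Qed.

Lemma layout_inr j : layout (inr j) \notin K.
Proof. by rewrite -lE mem_nth // size_layout. Qed.

Lemma layout_inj : injective layout.
Proof.
case=> [i|i] [j|j] /eqP.
- by rewrite nth_uniq ?enum_uniq -?cardE ?cardK // => /eqP/val_inj ->.
- by move=> /eqP e; have := layout_inr j; rewrite -e layout_inl.
- by move=> /eqP e; have := layout_inr i; rewrite e layout_inl.
- by rewrite nth_uniq ?size_layout // => /eqP/val_inj ->.
Qed.

Lemma layout_bij : bijective layout.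
Proof.
apply: inj_card_bij layout_inj _; rewrite card_sum !card_ord.
by rewrite -size_layout -cardK -(cardsC K) leq_add2l -(card_uniqP Ul)
  eq_leq //; apply: eq_card => v; rewrite lE inE.
Qed.

Lemma layout_adj i j :
  (forall i' j', i = inr i' -> j = inr j' -> false) ->
  adj (layout i) (layout j) = adj (s := S_graph (graph_order G) k) i j.
Proof.
case: i j => [i|i] [j|j] H.
- rewrite [RHS]/(i != j); have [->|ij] := eqVneq i j; first by rewrite adj_irrefl.
  apply: clique; rewrite ?layout_inl //.
  by apply: contraNneq ij => /layout_inj [->].
- by rewrite /= adj_sym; apply: joined; [apply: layout_inr|apply: layout_inl].
- by rewrite /=; apply: joined; [apply: layout_inr|apply: layout_inl].
- by have := H i j erefl erefl.
Qed.
End Recognition.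

Lemma isomorphic_of_inverse (G H : sgraph) (g : H -> G) : bijective g ->
  (forall i j, adj (g i) (g j) = adj i j) -> isomorphic G H.
Proof.
move=> [f gK fK] gadj; exists f; split; first by exists g.
by move=> x y; rewrite -gadj !fK.
Qed.

Lemma isomorphic_S_graph (G : sgraph) k (K : {set G}) (z : G) : #|K| = k ->
  {in K &, forall u v, u != v -> adj u v} ->
  (forall v w, v \notin K -> w \in K -> adj v w) ->
  (forall u v, u \notin K -> v \notin K -> ~~ adj u v) ->
  isomorphic G (S_graph (graph_order G) k).
Proof.
move=> Kk clique joined indep; pose l := enum (~: K).
have lE v : (v \in l) = (v \notin K) by rewrite mem_enum inE.
have Ul : uniq l := enum_uniq _.
apply: (@isomorphic_of_inverse G (S_graph (graph_order G) k) (@layout G k K l z)).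
  exact: layout_bij.
case=> [i|i] [j|j]; try by apply: layout_adj.
by apply/negbTE/indep; apply: (layout_inr z Kk Ul lE).
Qed.

Lemma isomorphic_Splus_graph (G : sgraph) k (K : {set G}) (a b : G) : #|K| = k ->
  a \notin K -> b \notin K -> adj a b ->
  {in K &, forall u v, u != v -> adj u v} ->
  (forall v w, v \notin K -> w \in K -> adj v w) ->
  (forall u v, u \notin K -> v \notin K -> adj u v -> u = a \/ u = b) ->
  isomorphic G (Splus_graph (graph_order G) k).
Proof.
move=> Kk aK bK ab clique joined only.
have abN : a != b by apply: contraTneq ab => ->; rewrite adj_irrefl.
pose l := [:: a, b & enum (~: K :\ a :\ b)].
have lE v : (v \in l) = (v \notin K).
  rewrite !inE mem_enum !inE; have [->|va] := eqVneq v a; first by rewrite aK.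
  by have [->|vb] := eqVneq v b; first by rewrite bK.
have Ul : uniq l.
  by rewrite /= enum_uniq inE negb_or abN !mem_enum !inE !eqxx andbF.
apply: (@isomorphic_of_inverse G (Splus_graph (graph_order G) k) (@layout G k K l a)).
  exact: layout_bij.
move=> i j; have [[i' [j' [-> ->]]]|ij] := pselect (exists i' j', i = inr i' /\ j = inr j').
  move: i' j' => {}i {}j.
  have inr_K (m : 'I_(graph_order G - k)) : nth a l m \notin K.
    exact: (layout_inr a Kk Ul lE m).
  have l0 (m : 'I_(graph_order G - k)) : (m == 0 :> nat) = (nth a l m == a).
    have ml : (m < size l)%N by rewrite (size_layout Kk Ul lE).
    by rewrite -[a in RHS]/(nth a l 0) nth_uniq.
  have l1 (m : 'I_(graph_order G - k)) : (m == 1 :> nat) = (nth a l m == b).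
    have ml : (m < size l)%N by rewrite (size_layout Kk Ul lE).
    by rewrite -[b in RHS]/(nth a l 1) nth_uniq.
  rewrite /= /Splus_adj /= !l0 !l1; have := inr_K i; have := inr_K j.
  move: (nth a l i) (nth a l j) => u v vK uK.
  apply/idP/orP => [uv|[] /andP[/eqP-> /eqP->] //]; last by rewrite adj_sym.
  have vu : adj v u by rewrite adj_sym.
  move: (uv); case: (only _ _ uK vK uv) => ->; case: (only _ _ vK uK vu) => ->;
    rewrite ?adj_irrefl // !eqxx; by [left|right].
transitivity (adj (s := S_graph (graph_order G) k) i j).
  by apply: layout_adj => // i' j' e e'; case: ij; exists i', j'.
by case: i j ij => [i|i] [j|j] ij; rewrite /= /Splus_adj ?orbF //; case: ij; exists i, j.
Qed.

Lemma contains_broomS (G : sgraph) s t :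
  contains G (broom s.+1 t) -> contains G (broom s t).
Proof.
move=> [f [f_inj fadj]].
pose g (i : broom s t) : broom s.+1 t :=
  match i with inl i => inl (lift ord0 i) | inr j => inr j end.
exists (f \o g); split.
  apply: inj_comp f_inj _; case=> [i|i] [j|j] //=.
    by case=> /addnI e; congr inl; apply/val_inj.
  by case=> ->.
by move=> x y xy; apply: fadj; case: x y xy => [i|i] [j|j].
Qed.

Lemma sparse_of_no_broom (G : sgraph) s t : (0 < s)%N -> (0 < t)%N ->
  ~ contains G (broom s t) -> forall X : {set G},
  (\sum_(u in X) #|nbr u :&: X| <= (s + t - 2).*2 * #|X|)%N.
Proof.
move=> s0 t0 nb X; apply: sparse_of_degenerate => Y Y0.
case: (pickP [pred v in Y | #|nbr v :&: Y| <= s + t - 2]%N) => [v /andP[]|none].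
  by exists v.
case: nb; apply: (broom_of_min_degree s0 t0 Y0) => v vY.
have := none v; rewrite /= vY /= => /negbT; rewrite -ltnNge; clear -s0 t0; lia.
Qed.

(** * Graphs of large order missing a broom *)

(** Collects the ways in which a large order is used; the bound [N2] on [lam]
    comes from [lam ^+ 2 >= n]. *)
Lemma large_order (R : realType) (k N1 N2 : nat) : (1 < k)%N ->
  exists n0 : nat, forall (n : nat) (lam : R), (n0 <= n)%N -> 0 < lam ->
    k%:R * (n%:R - k%:R) <= lam ^+ 2 ->
    [/\ (N1 <= n)%N, n%:R <= lam ^+ 2, k%:R * n%:R <= 2 * lam ^+ 2 & N2%:R <= lam].
Proof.
move=> k1; exists (N1 + N2 ^ 2 + 2 * k)%N => n lam nn lam0 lam2.
have n1 : (N1 <= n)%N by clear -nn; lia.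
have n2 : (N2 ^ 2 <= n)%N by clear -nn; lia.
have nk : 2 * k%:R <= n%:R :> R by rewrite -natrM ler_nat; clear -nn; lia.
have k2 : 2 <= k%:R :> R by rewrite ler_nat.
have kn : k%:R * n%:R <= 2 * lam ^+ 2 by nra.
have nlam : n%:R <= lam ^+ 2.
  have : 2 * n%:R <= k%:R * n%:R :> R by rewrite ler_wpM2r.
  lra.
split=> //.
rewrite -(@ler_pXn2r _ 2) ?nnegrE // ?(ltW lam0) //.
by apply: le_trans nlam; rewrite -natrX ler_nat.
Qed.

(** For a missing broom of order [2k + 3] the constants of [dominating_set] depend
    on [k] only, so that all its conditions hold for large order. *)
Lemma dominating_core (R : realType) (k : nat) : (1 < k)%N ->
  exists n0 : nat, forall (G : sgraph) (x : G -> R) (z : G) (lam : R) (s t : nat),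
    (n0 <= #|G|)%N -> 0 < lam ->
    (forall v, x v <= 1) -> x z = 1 ->
    (forall v, lam * x v <= \sum_(u in nbr v) x u) ->
    k%:R * (#|G|%:R - k%:R) <= lam ^+ 2 ->
    (0 < s)%N -> (0 < t)%N -> (s + t = 2 * k + 3)%N -> ~ contains G (broom s t) ->
    exists K : {set G}, [/\ #|K| = k, (15 * #|G| <= 16 * #|common_nbr K|)%N,
      k%:R - 1 / 16 <= \sum_(w in K) x w,
      4 * k%:R * (k%:R + 1) <= lam &
      (32 * k ^ 2 <= #|G|)%N /\ #|~: (K :|: common_nbr K)|%:R * (4 * k%:R) <= lam ^+ 2].
Proof.
move=> k1; pose c := (2 * k + 3 - 2).*2; pose l := (64 * c ^ 3)%N.
pose m := (2 * k + 3)%N.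
pose N1 := (32 * (k ^ 2 + 2 ^ l * m * l))%N.
pose N2 := (c ^ 5 * 16384 + 4 * k * (k + 1))%N.
have [n0 n0P] := large_order R N1 N2 k1.
exists n0 => G x z lam s t nG lam0 x1 xz sub lam2 s0 t0 st nb.
have [nN1 nlam knlam N2lam] := n0P _ _ nG lam0 lam2.
have sparse := sparse_of_no_broom s0 t0 nb; rewrite st -/c in sparse.
have c0 : 0 < c%:R :> R by rewrite ltr0n /c; clear; lia.
have c1 : 1 <= c%:R :> R by rewrite ler1n -(ltr_nat R).
(* The walks ending below level [a] then have total weight at most [n / 32]. *)
pose a : R := (32 * c%:R)^-1.
have aC : a * (32 * c%:R) = 1 by rewrite mulVf // mulf_neq0 // gt_eqF.
have a0 : 0 < a by rewrite invr_gt0 mulr_gt0.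
have a1 : a <= 1 by rewrite -aC ler_peMr ?(ltW a0) //; lra.
have n_gt0 : 0 < #|G|%:R :> R by rewrite ltr0n; apply/card_gt0P; exists z.
move: N2lam; rewrite /N2 natrD natrM natrX (natrM _ (4 * k)) natrM natrD => N2lam.
have k0 : 0 <= k%:R :> R by [].
have kk0 : 0 <= k%:R * k%:R :> R by rewrite mulr_ge0.
have c5 : 0 <= c%:R ^+ 5 :> R by rewrite exprn_ge0.
have cardL : (#|level x a| <= l)%N.
  apply: (card_level_bounded lam0 x1 sub sparse c0 n_gt0 nlam _ aC); lra.
have k_gt0 : (0 < k)%N by exact: ltnW.
have tk : (t <= k.*2 + 2)%N by clear -st s0; lia.
have mst : (s + t <= m.+1)%N by clear -st; rewrite /m; lia.
have mk : (k + 3 <= m)%N by clear -k1; rewrite /m; lia.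
have a01 : 0 < a <= 1 by rewrite a0.
have aC' : a * c%:R * 32 <= 1 by lra.
have nN : 32 * (k%:R ^+ 2 + (2 ^ l * m * l)%:R) <= #|G|%:R :> R.
  by rewrite -natrX -natrD -natrM ler_nat.
have [K [Kk KA sumK]] := dominating_set lam0 x1 sub sparse k_gt0 t0 tk mst mk nb
  a01 cardL xz aC' lam2 nN.
exists K.
have KA' : (15 * #|G| <= 16 * #|common_nbr K|)%N.
  by rewrite -(ler_nat R) !natrM; lra.
split=> //; first lra.
split.
  by apply: leq_trans nN1; rewrite /N1 leq_mul2l leq_addr orbT.
have : (16 * #|~: (K :|: common_nbr K)| <= #|G|)%N.
  have := cardsC (K :|: common_nbr K); have := subset_leq_card (subsetUr K (common_nbr K)).
  clear -KA'; lia.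
rewrite -(ler_nat R) natrM => D16.
have : 4 * k%:R * (16 * #|~: (K :|: common_nbr K)|%:R) <= 4 * k%:R * #|G|%:R :> R.
  by rewrite ler_wpM2l // mulr_ge0.
have : 0 <= lam ^+ 2 by rewrite exprn_ge0 // ltW.
lra.
Qed.

(** * From missing brooms to the structure around the core *)

Section Conclusion.
Variables (G : sgraph) (k s t : nat) (K : {set G}).
Hypothesis k_gt1 : (1 < k)%N.
Hypothesis cardK : #|K| = k.
Hypothesis many : (2 * k + 6 <= #|common_nbr K|)%N.
Hypotheses (t_gt0 : (0 < t)%N) (st : (s + t <= 2 * k + 3)%N).
Hypothesis no_broom : ~ contains G (broom s t).

Lemma isolated_of_no_broom : (t <= 2 * k + 1)%N -> forall v b,
  v \notin K -> b \notin K -> (0 < #|nbr v :&: K|)%N -> adj v b -> False.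
Proof.
move=> tk v b vK bK /card_gt0P[w]; rewrite !inE => /andP[vw wK] vb.
apply: no_broom; apply: (@broom_of_tail _ _ _ K w [:: v; b]) => //=.
- by rewrite adj_sym vw vb.
- by rewrite inE andbT; apply: contraTneq vb => ->; rewrite adj_irrefl.
- by move=> u; rewrite !inE => /orP[] /eqP->.
- by rewrite cardK; clear -tk; lia.
- by clear -st many; lia.
- by rewrite cardK; clear -many; lia.
Qed.

Lemma pendant_of_no_broom : (0 < s)%N -> forall v b c, v \notin K -> b \notin K -> c \notin K ->
  (0 < #|nbr v :&: K|)%N -> adj v b -> adj b c -> c = v.
Proof.
move=> s0 v b c vK bK cK /card_gt0P[w]; rewrite !inE => /andP[vw wK] vb bc.
apply/eqP/negPn/negP => cv; apply: no_broom.
apply: (@broom_of_tail _ _ _ K w [:: v; b; c]) => //=.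
- by rewrite adj_sym vw vb bc.
- rewrite !inE !andbT negb_or [v == c]eq_sym cv andbT; apply/andP; split.
    by apply: contraTneq vb => ->; rewrite adj_irrefl.
  by apply: contraTneq bc => ->; rewrite adj_irrefl.
- by move=> u; rewrite !inE => /or3P[] /eqP->.
- by rewrite cardK; clear -st s0; lia.
- by clear -st many; lia.
- by rewrite cardK; clear -many; lia.
Qed.

Lemma matching_of_no_broom : s = 1%N -> t = (2 * k + 2)%N -> forall a b a' b',
  a \in common_nbr K -> b \notin K -> a' \in common_nbr K -> b' \notin K ->
  adj a b -> adj a' b' -> ~~ uniq [:: a; b; a'; b'].
Proof.
move=> s1 t2 a b a' b' aA bK a'A b'K ab ab'; apply/negP => U.
apply: no_broom; rewrite s1; apply: (broom_of_two_edges _ _ _ aA a'A ab ab') => //.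
- by rewrite cardK; clear -t2; lia.
- by rewrite cardK.
- by rewrite cardK; clear -many; lia.
Qed.
End Conclusion.

Lemma core_positive (R : realType) (G : sgraph) (x : G -> R) k (K : {set G}) :
  #|K| = k -> (forall v, x v <= 1) -> k%:R - 1 / 16 <= \sum_(w in K) x w ->
  forall w, w \in K -> 0 < x w.
Proof.
move=> Kk x1 sumK w wK.
have H : \sum_(u in K :\ w) x u <= (k%:R - 1) * 1.
  have -> : k%:R - 1 = #|K :\ w|%:R :> R.
    by rewrite -Kk (cardsD1 w K) wK natrD addrC addKr.
  exact: sum_le_card.
move: sumK; rewrite (big_setD1 w) //=; lra.
Qed.

Theorem theorem1p5 (R : realType) (k : nat) (hk : (2 <= k)%N) :
  exists n0 : nat, forall G : sgraph, (n0 <= graph_order G)%N ->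
    (spectral_radius R (S_graph (graph_order G) k) <= spectral_radius R G ->
       (forall s t : nat, (1 <= s)%N -> (1 <= t)%N -> (s + t = 2 * k + 2)%N ->
          contains G (broom s t)) \/
       isomorphic G (S_graph (graph_order G) k)) /\
    (spectral_radius R (Splus_graph (graph_order G) k) <= spectral_radius R G ->
       (forall s t : nat, (1 <= s)%N -> (1 <= t)%N -> (s + t = 2 * k + 3)%N ->
          contains G (broom s t)) \/
       isomorphic G (Splus_graph (graph_order G) k)).
Proof.
have [n0 n0P] := dominating_core R hk.
exists (n0 + k + 5)%N => G nG.
have nG0 : (n0 <= #|G|)%N by apply: leq_trans nG; rewrite -addnA leq_addr.
have nk5 : (k + 5 <= graph_order G)%N.
  by apply: leq_trans nG; rewrite -addnA leq_addl.
have k0 : (0 < k)%N by exact: ltnW.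
have [|x [z [x0 x1 xz sub]]] := @sub_eigenvector R G; first by clear -nk5; lia.
set lam := spectral_radius R G in sub *.
have many (K : {set G}) : (15 * #|G| <= 16 * #|common_nbr K|)%N ->
    (32 * k ^ 2 <= #|G|)%N -> (2 * k + 6 <= #|common_nbr K|)%N.
  have : (2 * k <= k ^ 2)%N by rewrite -mulnn leq_pmul2r.
  clear -hk; lia.
split=> mulam.
- have [|lam0 lower] := S_graph_radius _ mulam; first by rewrite k0; clear -nk5; lia.
  case: (pselect (forall s t : nat, (1 <= s)%N -> (1 <= t)%N ->
    (s + t = 2 * k + 2)%N -> contains G (broom s t))) => [all|notall]; first by left.
  right; have [s [t [s0 t0 st nb]]] : exists s t,
      [/\ (0 < s)%N, (0 < t)%N, (s + t = 2 * k + 2)%N & ~ contains G (broom s t)].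
    apply: contrapT => none; apply: notall => s t s0 t0 st; apply: contrapT => nb.
    by apply: none; exists s, t.
  have lam2 : k%:R * (#|G|%:R - k%:R) <= lam ^+ 2.
    apply: le_trans lower; rewrite lerDr mulr_ge0 ?(ltW lam0) // subr_ge0 ler1n //.
  (* Part (a) also starts from a missing broom of order 2k + 3: with one leaf
     more. *)
  have st' : (s.+1 + t = 2 * k + 3)%N by clear -st; lia.
  have nb' : ~ contains G (broom s.+1 t) by move/contains_broomS.
  have [K [Kk KA sumK lamk [nk2 _]]] :=
    n0P G x z lam s.+1 t nG0 lam0 x1 xz sub lam2 isT t0 st' nb'.
  have KA' := many K KA nk2.
  have st2 : (s + t <= 2 * k + 3)%N by rewrite st leq_add2l.
  have tk : (t <= 2 * k + 1)%N by clear -st s0; lia.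
  have iso := isolated_of_no_broom Kk KA' t0 st2 nb tk.
  have [clique joined] := isolated_extremal lam0 x0 sub k0 Kk
    (core_positive Kk x1 sumK) iso lower.
  apply: (isomorphic_S_graph z Kk) => // u v uK vK; apply/negP => uv.
  apply: (iso u v uK vK) => //; apply/card_gt0P.
  have [w wK] : exists w, w \in K by apply/card_gt0P; rewrite Kk.
  by exists w; rewrite !inE joined.
- have [lam2 lower] := Splus_graph_radius k0 nk5 mulam.
  have lam0 : 0 < lam by lra.
  case: (pselect (forall s t : nat, (1 <= s)%N -> (1 <= t)%N ->
    (s + t = 2 * k + 3)%N -> contains G (broom s t))) => [all|notall]; first by left.
  right; have [s [t [s0 t0 st nb]]] : exists s t,
      [/\ (0 < s)%N, (0 < t)%N, (s + t = 2 * k + 3)%N & ~ contains G (broom s t)].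
    apply: contrapT => none; apply: notall => s t s0 t0 st; apply: contrapT => nb.
    by apply: none; exists s, t.
  have lower0 : (k%:R - 1) * lam + k%:R * (#|G|%:R - k%:R) < lam ^+ 2.
    have : 0 < (lam - 1) * (lam ^+ 2 - (k%:R - 1) * lam - k%:R * (#|G|%:R - k%:R)).
      by apply: lt_le_trans lower; rewrite mulr_gt0 // ltr0n.
    rewrite pmulr_rgt0; lra.
  have lam2' : k%:R * (#|G|%:R - k%:R) <= lam ^+ 2.
    apply: le_trans (ltW lower0); rewrite lerDr mulr_ge0 ?(ltW lam0) // subr_ge0 ler1n //.
  have [K [Kk KA sumK lamk [nk2 D_small]]] :=
    n0P G x z lam s t nG0 lam0 x1 xz sub lam2' s0 t0 st nb.
  have KA' := many K KA nk2.
  have xK := core_positive Kk x1 sumK.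
  have st2 : (s + t <= 2 * k + 3)%N by rewrite st.
  have [tk|tk] := leqP t (2 * k + 1).
    have iso := isolated_of_no_broom Kk KA' t0 st2 nb tk.
    have := isolated_spectral lam0 x0 sub k0 Kk xK iso.
    by rewrite leNgt lower0.
  (* Only the path on 2k + 3 vertices is left. *)
  have s1 : s = 1%N by clear -st s0 tk; lia.
  have t2 : t = (2 * k + 2)%N by clear -st s0 tk; lia.
  have pend := pendant_of_no_broom Kk KA' t0 st2 nb s0.
  have mat := matching_of_no_broom hk Kk KA' nb s1 t2.
  have [a [b [[aK bK ab] [clique joined only]]]] := pendant_extremal
    lam0 x0 x1 sub k0 Kk xK pend mat hk sumK lamk D_small lower.
  exact: (isomorphic_Splus_graph Kk aK bK ab).
Qed.
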